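(* Suppose $f\colon \mathbb{N} \to \{0,1\}$ is a computable partial function with no computable completion. Then every set $A \subseteq \mathbb{N}$ of positive lower density contains an infinite subset which does not compute a completion of $f$.
   Context: A completion of a partial function $f\colon \mathbb{N}\to\{0,1\}$ is a total function $g\colon\mathbb{N}\to\{0,1\}$ with $g(n)=f(n)$ for every $n$ in the domain of $f$. The lower density of $A$ is $\liminf_{n\to\infty}\frac{|A\cap\{0,\ldots,n\}|}{n+1}$. *)

(* Defs.v *)
From mathcomp Require Import all_boot all_order all_algebra.
From mathcomp Require Import all_classical all_reals all_analysis.

Set Implicit Arguments.
Unset Strict Implicit.
Unset Printing Implicit Defensive.

Import Order.TTheory GRing.Theory Num.Theory.

Local Open Scope classical_set_scope.
Local Open Scope ring_scope.

(* Kleene's mu-recursive functions, with the characteristic function of an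
   oracle set as an additional initial function.  Arities are not tracked:
   arguments come as a list, and a missing argument reads as 0. *)
Inductive program : Type :=
| Zero
| Succ
| Proj of nat
| Oracle
| Comp of program & seq program
| Prec of program & program
| Mu of program.

(* [halts_with O c xs y]: with oracle O, the program c halts on the arguments xs
   with output y.  It is a relation since programs may diverge.
   Prec g h computes F(0, xs) = g(xs), F(n + 1, xs) = h(n, F(n, xs), xs).
   Mu g computes the least y with g(y, xs) = 0, and diverges if some earlier
   value g(i, xs) does. *)
Fixpoint halts_with (O : set nat) (c : program) : seq nat -> nat -> Prop :=
  match c with
  | Zero => fun xs y => y = 0%N
  | Succ => fun xs y => y = (nth 0%N xs 0).+1
  | Proj i => fun xs y => y = nth 0%N xs i
  | Oracle => fun xs y => y = nat_of_bool (nth 0%N xs 0 \in O)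
  | Comp g hs => fun xs y =>
      exists2 zs,
        (fix evals (hs : seq program) (zs : seq nat) : Prop :=
           match hs, zs with
           | [::], [::] => True
           | h :: hs', z :: zs' => halts_with O h xs z /\ evals hs' zs'
           | _, _ => False
           end) hs zs
        & halts_with O g zs y
  | Prec g h => fun xs y =>
      (fix rec (n : nat) (y : nat) : Prop :=
         match n with
         | 0%N => halts_with O g (behead xs) y
         | m.+1 => exists2 z, rec m z & halts_with O h [:: m, z & behead xs] y
         end) (nth 0%N xs 0) y
  | Mu g => fun xs y =>
      halts_with O g (y :: xs) 0%N /\
      forall i, (i < y)%N -> exists v, halts_with O g (i :: xs) v.+1
  end.

Fixpoint oracle_free (c : program) : bool :=
  match c with
  | Oracle => false
  | Comp g hs => oracle_free g && all oracle_free hs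
  | Prec g h => oracle_free g && oracle_free h
  | Mu g => oracle_free g
  | _ => true
  end.

(* Partial functions N -> {0,1} are maps [nat -> option bool]; [None] means
   undefined, in which case the program has to diverge. *)
Definition program_for (O : set nat) (c : program) (f : nat -> option bool) : Prop :=
  forall n y, halts_with O c [:: n] y <-> exists2 b : bool, f n = Some b & y = nat_of_bool b.

(* The oracle of an oracle-free program is irrelevant. *)
Definition computable (f : nat -> option bool) : Prop :=
  exists2 c, oracle_free c & program_for set0 c f.

Definition computes (B : set nat) (f : nat -> option bool) : Prop :=
  exists c, program_for B c f.

Definition as_partial (g : nat -> bool) : nat -> option bool := fun n => Some (g n).

Definition completion (f : nat -> option bool) (g : nat -> bool) : Prop :=
  forall n b, f n = Some b -> g n = b.

Definition lower_density (R : realType) (A : set nat) : \bar R :=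
  limn_einf (fun n => (#|[pred i : 'I_n.+1 | (i : nat) \in A]|%:R / n.+1%:R)%:E).

(* Main.v *)
(* Let F_n = [b^n, b^(n+1)). For a suitable base b the set A has a fixed positive
   density in every block F_n with n large. Assume that every infinite subset of A
   computes a completion of f; we build an infinite B included in A that does not,
   by forcing with finite stems and Pi^0_1 classes of reservoirs.

   A condition is a Pi^0_1 class of colourings of N by finitely many sides, each
   side a carrying a stem F_a included in A. As long as some extension of F_a
   inside A and the reservoir of a makes the next functional contradict f, extend
   F_a. Otherwise let the candidates be the pairs (X, Y) of a colouring X in the
   class and a set Y which, in every block, is dense in some active side, and from
   which no contradiction with f can be obtained; (X, A) is one of them. Since f has
   no computable completion, compactness yields inputs x_1, ..., x_k and 2^k
   candidates such that any two of them avoid opposite outputs at some x_i. For k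
   large, in each block two of these candidates overlap in a definite fraction of
   the same side, and on the overlap the functional gives no output at all at that
   x_i. The overlap becomes a new side, on which the requirement is met, and the
   rest of the old side is kept; so nothing is lost, and A remains dense in some
   side of each block. In a given block a side can be split only boundedly often,
   hence Koenig's lemma, applied to the histories of blocks and then to the tree of
   sides, produces a sequence of sides, each split off from the previous one and
   with reservoirs meeting A infinitely often. The union of their stems is B. *)
Require Import Defs.
From mathcomp Require Import all_boot all_order all_algebra.
From mathcomp Require Import all_classical all_reals all_analysis.
From mathcomp Require Import zify.

Set Implicit Arguments.
Unset Strict Implicit.
Unset Printing Implicit Defensive.

Local Open Scope classical_set_scope.
Local Open Scope nat_scope.

(** * Step-bounded evaluation *)

(** The induction principle generated for [program] gives no hypothesis for the programs listed in
    [Comp]; the inner [elim] under [fix] supplies it. *)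
Lemma program_nested_ind (P : program -> Prop) :
  P Zero -> P Succ -> (forall i, P (Proj i)) -> P Oracle ->
  (forall g hs, P g -> (forall h, List.In h hs -> P h) -> P (Comp g hs)) ->
  (forall g h, P g -> P h -> P (Prec g h)) -> (forall g, P g -> P (Mu g)) ->
  forall c, P c.
Proof.
move=> PZ PS PP PO PC PR PM; fix IH 1; case=> [||i||g hs|g h|g].
- exact: PZ.
- exact: PS.
- exact: PP.
- exact: PO.
- apply: PC; first exact: IH.
  elim: hs => [h' []|h hs IHhs h' [<-|h'hs]]; first exact: IH.
  exact: (IHhs h' h'hs).
- apply: PR; exact: IH.
- apply: PM; exact: IH.
Qed.

(* [y.+1] means output [y], [0] means no output yet.
   Oracle queries at or beyond the bound [s] are refused. *)
Fixpoint run (O : nat -> bool) (s : nat) (c : program) (xs : seq nat) : nat :=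
  match c with
  | Zero => 1
  | Succ => (nth 0 xs 0).+2
  | Proj i => (nth 0 xs i).+1
  | Oracle => (nth 0 xs 0 < s) * (O (nth 0 xs 0)).+1
  | Comp g hs =>
      let zs := [seq run O s h xs | h <- hs] in
      \prod_(z <- zs) (0 < z) * run O s g [seq z.-1 | z <- zs]
  | Prec g h =>
      (fix rec n := match n with
        | 0 => run O s g (behead xs)
        | m.+1 => (0 < rec m) * run O s h [:: m, (rec m).-1 & behead xs]
        end) (nth 0 xs 0)
  | Mu g =>
      let y := \sum_(k < s) \prod_(i < k.+1) (run O s g (val i :: xs) != 1) in
      (y < s) * (\prod_(i < y) (0 < run O s g (val i :: xs))) * y.+1
  end.

Lemma prodb01 (I : eqType) (r : seq I) (P : I -> bool) :
  \prod_(i <- r) P i = (all P r : nat).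
Proof.
by elim: r => [|i r IH]; rewrite ?big_nil // big_cons IH /=; case: (P i); rewrite ?mul1n.
Qed.

Lemma prodb_ord (n : nat) (P : nat -> bool) :
  \prod_(i < n) P (val i) = (all P (iota 0 n) : nat).
Proof.
by rewrite -(big_mkord xpredT (fun i => nat_of_bool (P i))) prodb01 /index_iota subn0.
Qed.

(** The [k]-th summand is 1 as long as no index up to [k] satisfies [P]. Sums and products are what
    the closure lemmas for [recfun] handle, so [run] states minimisation in this form. *)
Lemma sum_first (n : nat) (P : nat -> bool) :
  \sum_(k < n) \prod_(i < k.+1) ~~ P (val i) = find P (iota 0 n).
Proof.
under eq_bigr => k _ do rewrite (prodb_ord k.+1 (fun i => ~~ P i)).
elim: n => [|n IH]; first by rewrite big_ord0.
have E : iota 0 n.+1 = iota 0 n ++ [:: n] by rewrite -addn1 iotaD.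
rewrite big_ord_recr IH [nat_of_ord _](_ : _ = n) // E all_cat find_cat size_iota.
rewrite !(all_predC P).
case: ifP => [_|hn]; first exact: addn0.
by rewrite (hasNfind (negbT hn)) size_iota /=; case: (P n).
Qed.

(** The value 1 encodes the output 0, so this is the least zero found below [s], and [s] itself if
    there is none. *)
Definition mu_bound (s : nat) (v : nat -> nat) : nat :=
  find (fun i => v i == 1) (iota 0 s).

Lemma run_mu O s g xs :
  let v := fun i => run O s g (i :: xs) in
  run O s (Mu g) xs = (mu_bound s v < s) *
    (all (fun i => 0 < v i) (iota 0 (mu_bound s v))) * (mu_bound s v).+1.
Proof.
move=> v /=; rewrite (sum_first s (fun i => v i == 1)) -/(mu_bound s v).
by rewrite (prodb_ord _ (fun i => 0 < v i)).
Qed.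

Lemma mu_boundP s (v : nat -> nat) y :
  (mu_bound s v < s) * (all (fun i => 0 < v i) (iota 0 (mu_bound s v))) * (mu_bound s v).+1 = y.+1
  <-> [/\ y < s, v y = 1 & forall i, i < y -> 1 < v i].
Proof.
split.
  case: ltnP => // lt_ms; rewrite mul1n.
  case: (boolP (all _ _)) => // /allP pos; rewrite mul1n => -[<-].
  have hm : has (fun i => v i == 1) (iota 0 s) by rewrite has_find size_iota.
  have := nth_find 0 hm; rewrite nth_iota // add0n => /eqP v1; split=> // i lti.
  have := pos i; rewrite mem_iota /= add0n => /(_ lti).
  have := before_find 0 lti; rewrite nth_iota ?add0n; last exact: ltn_trans lti lt_ms.
  by case: (v i) => [|[]].
case=> lt_ys vy vi.
have hm : mu_bound s v = y.
  apply/eqP; rewrite eqn_leq; apply/andP; split; rewrite leqNgt; apply/negP => lt.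
    by have := before_find 0 lt; rewrite nth_iota // add0n vy.
  have lt_ms := ltn_trans lt lt_ys.
  have hm : has (fun i => v i == 1) (iota 0 s) by rewrite has_find size_iota.
  by have := nth_find 0 hm; rewrite nth_iota // add0n => /eqP vm; have := vi _ lt; rewrite vm.
rewrite hm lt_ys; suff -> : all (fun i => 0 < v i) (iota 0 y) by rewrite !mul1n.
by apply/allP => i; rewrite mem_iota /= add0n => /vi /ltnW.
Qed.

Lemma guard_mul (b : bool) z y : b * z = y.+1 <-> b /\ z = y.+1.
Proof. by case: b; rewrite ?mul1n ?mul0n; split=> // -[]. Qed.

Lemma run_comp O s g hs xs y :
  run O s (Comp g hs) xs = y.+1 <->
  (forall h, List.In h hs -> 0 < run O s h xs) /\
  run O s g [seq (run O s h xs).-1 | h <- hs] = y.+1.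
Proof.
rewrite /= prodb01 all_map -map_comp.
have E : all (preim (fun h => run O s h xs) (fun z => 0 < z)) hs <->
          (forall h, List.In h hs -> 0 < run O s h xs).
  elim: hs => [|h hs IH] /=; first by split.
  split=> [/andP[h0 /IH H] h' [<-|/H]//|H].
  by apply/andP; split; [apply: H; left | apply/IH => h' hh'; apply: H; right].
by rewrite guard_mul; split=> -[/E].
Qed.

Lemma run_prec O s g h xs :
  let c := Prec g h in
  (forall xs', run O s c (0 :: xs') = run O s g xs') /\
  (forall m xs', run O s c (m.+1 :: xs') =
     (0 < run O s c (m :: xs')) * run O s h [:: m, (run O s c (m :: xs')).-1 & xs']) /\
  run O s c xs = run O s c (nth 0 xs 0 :: behead xs).
Proof. by []. Qed.

(** A run with an output has queried the oracle only below [s], and by induction all the values it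
    relies on persist. This gives both monotonicity in the bound and the use principle. *)
Lemma run_ext (O O' : nat -> bool) s s' c xs y :
  (forall i, i < s -> O i = O' i) -> s <= s' ->
  run O s c xs = y.+1 -> run O' s' c xs = y.+1.
Proof.
move=> OO' ss'; elim/program_nested_ind: c xs y => [||i||g hs IHg IHhs|g h IHg IHh|g IHg] xs y //.
- rewrite /= !guard_mul => -[lt_s <-]; split; last by rewrite OO'.
  exact: leq_trans lt_s ss'.
- rewrite !run_comp => -[pos Eg].
  have Eh h : List.In h hs -> run O' s' h xs = run O s h xs.
    by move=> hhs; have := pos h hhs; case E: (run O s h xs) => [//|z] _; apply: IHhs.
  split=> [h hhs|]; first by rewrite Eh // pos.
  suff <- : [seq (run O s h xs).-1 | h <- hs] = [seq (run O' s' h xs).-1 | h <- hs] by apply: IHg.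
  elim: hs Eh {IHhs pos Eg} => //= h hs IH Eh; rewrite Eh; last by left.
  by rewrite IH // => h' hh'; apply: Eh; right.
- rewrite (run_prec O s g h xs).2.2 (run_prec O' s' g h xs).2.2.
  elim: (nth 0 xs 0) y => [|m IHm] y; first exact: IHg.
  rewrite (run_prec O s g h xs).2.1 (run_prec O' s' g h xs).2.1 !guard_mul => -[].
  by case E: (run O s (Prec g h) (m :: _)) => [//|z] _; rewrite (IHm z E) => /IHh.
- rewrite !run_mu !mu_boundP => -[lt_ys vy vi]; split; first exact: leq_trans lt_ys ss'.
    exact: IHg vy.
  move=> i /vi; case E: (run O s g _) => [|[|z]] // _.
  by rewrite (IHg _ _ E).
Qed.

Lemma In_nth hs i : i < size hs -> List.In (nth Zero hs i) hs.
Proof.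
elim: hs i => [|h hs IH] [|i] //= lti; first by left.
by right; apply: IH.
Qed.

Lemma In_nth_ex (hs : seq program) h : List.In h hs ->
  exists2 i, i < size hs & nth Zero hs i = h.
Proof.
elim: hs => [//|h' hs IH] /= [<-|/IH[i lti <-]]; first by exists 0.
by exists i.+1.
Qed.

Lemma halts_comp O g hs xs y :
  halts_with O (Comp g hs) xs y <->
  exists2 zs, size zs = size hs /\
      (forall i, i < size hs -> halts_with O (nth Zero hs i) xs (nth 0 zs i))
    & halts_with O g zs y.
Proof.
have E zs : (fix evals (hs : seq program) (zs : seq nat) : Prop :=
           match hs, zs with
           | [::], [::] => True
           | h :: hs', z :: zs' => halts_with O h xs z /\ evals hs' zs'
           | _, _ => False
           end) hs zs <-> size zs = size hs /\
      (forall i, i < size hs -> halts_with O (nth Zero hs i) xs (nth 0 zs i)).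
  elim: hs zs => [|h hs IH] [|z zs]; try by split=> // -[].
  rewrite IH; split=> [[hz [sz H]]|[[sz] H]].
    by split=> [|[|i]]; rewrite /= ?sz //; apply: H.
  by split; [exact: (H 0)|split=> // i lti; apply: (H i.+1)].
by split=> -[zs /E Ezs Eg]; exists zs.
Qed.

(** A halting computation has finitely many subcomputations, each with a bound of its own; by
    monotonicity the maximum of these serves for all. *)
Lemma run_halts (O : set nat) c xs y :
  halts_with O c xs y <-> exists s, run (fun i => i \in O) s c xs = y.+1.
Proof.
set o := fun i => i \in O.
have mono s s' c' xs' y' : s <= s' -> run o s c' xs' = y'.+1 -> run o s' c' xs' = y'.+1.
  exact: run_ext.
elim/program_nested_ind: c xs y => [||i||g hs IHg IHhs|g h IHg IHh|g IHg] xs y.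
- by split=> [->|[s [<-]]]; first by exists 0.
- by split=> [->|[s [<-]]]; first by exists 0.
- by split=> [->|[s [<-]]]; first by exists 0.
- split=> [->|[s /=]]; last by rewrite guard_mul => -[_ [<-]].
  by exists (nth 0 xs 0).+1; rewrite /= ltnSn mul1n.
- rewrite halts_comp; split=> [[zs [sz Hh] /IHg[s Es]]|[s]].
    have [u [su Hu]] : exists u, s <= u /\ forall i, i < size hs ->
        run o u (nth Zero hs i) xs = (nth 0 zs i).+1.
      elim: {1 3}(size hs) (leqnn (size hs)) => [|n IHn] ltn; first by exists s.
      have [u [su Hu]] := IHn (ltnW ltn).
      have [v Ev] := (IHhs _ (In_nth ltn) xs _).1 (Hh n ltn).
      exists (maxn u v); split=> [|i]; first by rewrite leq_max su.
      rewrite ltnS leq_eqVlt => /orP[/eqP->|/Hu E].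
        exact: mono (leq_maxr _ _) Ev.
      exact: mono (leq_maxl _ _) E.
    exists u; rewrite run_comp; split.
      by move=> h /In_nth_ex[i lti <-]; rewrite Hu.
    suff -> : [seq (run o u h xs).-1 | h <- hs] = zs by apply: mono Es.
    apply: (@eq_from_nth _ 0); rewrite size_map // => i lti.
    by rewrite (nth_map Zero) // Hu.
  rewrite run_comp => -[pos Eg].
  exists [seq (run o s h xs).-1 | h <- hs]; last by apply/IHg; exists s.
  rewrite size_map; split=> // i lti; rewrite (nth_map Zero) //.
  apply/IHhs; first exact: In_nth.
  by exists s; rewrite prednK // pos //; exact: In_nth.
- rewrite /=; set rec := (fix rec (n y : nat) : Prop := _).
  have -> : (exists s, run o s (Prec g h) xs = y.+1) <->
            (exists s, run o s (Prec g h) (nth 0 xs 0 :: behead xs) = y.+1) by [].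
  elim: (nth 0 xs 0) y => [|m IHm] y; first exact: IHg.
  split=> [[z /IHm[s Es] /IHh[u Eu]]|[s]].
    exists (maxn s u); rewrite (run_prec o _ g h xs).2.1 guard_mul.
    rewrite (mono s _ _ _ z (leq_maxl _ _) Es) /=; split=> //.
    exact: mono (leq_maxr _ _) Eu.
  rewrite (run_prec o _ g h xs).2.1 guard_mul => -[].
  case E: (run o s (Prec g h) (m :: _)) => [//|z] _ Eh.
  by exists z; [apply/IHm; exists s | apply/IHh; exists s].
- split=> [[/IHg[s Es] H]|[s]]; last first.
    rewrite run_mu mu_boundP => -[_ vy vi]; split; first by apply/IHg; exists s.
    move=> i /vi; case E: (run o s g _) => [|[|z]] // _.
    by exists z; apply/IHg; exists s.
  have [u [su Hu]] : exists u, s <= u /\ forall i, i < y -> 1 < run o u g (i :: xs).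
    elim: {1 3}y (leqnn y) => [|n IHn] ltn; first by exists s.
    have [u [su Hu]] := IHn (ltnW ltn).
    have [v /IHg[w Ew]] := H n ltn.
    exists (maxn u w); split=> [|i]; first by rewrite leq_max su.
    rewrite ltnS leq_eqVlt => /orP[/eqP->|/Hu].
      by rewrite (mono _ _ _ _ _ (leq_maxr u w) Ew).
    case E: (run o u g _) => [|[|z]] // _.
    by rewrite (mono _ _ _ _ _ (leq_maxl u w) E).
  exists (maxn u y.+1); rewrite run_mu mu_boundP leq_max ltnSn orbT; split=> //.
    by apply: mono Es; rewrite leq_max su.
  move=> i /Hu; case E: (run o u g _) => [|[|z]] // _.
  by rewrite (mono _ _ _ _ _ (leq_maxl u y.+1) E).
Qed.

Lemma halts_inj O c xs y y' : halts_with O c xs y -> halts_with O c xs y' -> y = y'.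
Proof.
move=> /run_halts[s Es] /run_halts[u Eu].
have := run_ext (O' := fun i => i \in O) (fun i _ => erefl) (leq_maxl s u) Es.
have := run_ext (O' := fun i => i \in O) (fun i _ => erefl) (leq_maxr s u) Eu.
by move=> -> [].
Qed.

Lemma halts_use (O : set nat) c xs y : halts_with O c xs y ->
  exists u, forall O' : set nat, (forall i, i < u -> O i <-> O' i) -> halts_with O' c xs y.
Proof.
move=> /run_halts[u Eu]; exists u => O' OO'; apply/run_halts; exists u.
apply: run_ext Eu => // i ltu; apply/idP/idP => /set_mem Oi; apply/mem_set; exact/OO'.
Qed.

(** * Recursive functions *)

Definition recfun (k : nat) (phi : seq nat -> nat) : Prop :=
  exists2 c, oracle_free c &
    forall xs, size xs = k -> forall y, halts_with set0 c xs y <-> y = phi xs.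

Lemma recfun_ext k phi psi :
  (forall xs, size xs = k -> phi xs = psi xs) -> recfun k phi -> recfun k psi.
Proof. by move=> E [c oc H]; exists c => // xs sx y; rewrite H // E. Qed.

Lemma recfun_nth k i : recfun k (fun xs => nth 0 xs i).
Proof. by exists (Proj i). Qed.

Lemma recfun_args k (args : seq (seq nat -> nat)) :
  (forall i, i < size args -> recfun k (nth (fun=> 0) args i)) ->
  exists hs, [/\ size hs = size args, all oracle_free hs &
    forall xs, size xs = k -> forall i, i < size args -> forall y,
      halts_with set0 (nth Zero hs i) xs y <-> y = nth (fun=> 0) args i xs].
Proof.
elim: args => [|a args IH] H; first by exists [::].
have [|hs [sh oh Hh]] := IH; first by move=> i lti; apply: (H i.+1).
have [c oc Hc] := H 0 isT; exists (c :: hs); split=> [||xs sx [|i] lti y] /=.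
- by rewrite sh.
- by rewrite oc.
- exact: Hc.
- exact: Hh.
Qed.

Lemma recfun_comp k m phi args : size args = m -> recfun m phi ->
  (forall i, i < size args -> recfun k (nth (fun=> 0) args i)) ->
  recfun k (fun xs => phi [seq a xs | a : seq nat -> nat <- args]).
Proof.
move=> sa [c oc Hc] /recfun_args[hs [sh oh Hh]].
exists (Comp c hs) => [|xs sx y]; first by rewrite /= oc.
rewrite halts_comp; split=> [[zs [sz Hz]]|->].
  rewrite Hc ?sz ?sh // => ->; congr phi.
  apply: (@eq_from_nth _ 0); rewrite ?size_map ?sz // sh => i lti.
  by rewrite (nth_map (fun=> 0)) //; apply/(Hh xs sx i lti)/Hz; rewrite sh.
exists [seq a xs | a <- args]; last by apply/Hc => //; rewrite size_map.
rewrite size_map sh; split=> // i lti.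
by apply/(Hh xs sx i lti); rewrite (nth_map (fun=> 0)).
Qed.

Fixpoint prec_fun (g h : seq nat -> nat) (n : nat) (xs : seq nat) : nat :=
  if n is m.+1 then h (m :: prec_fun g h m xs :: xs) else g xs.

Lemma recfun_prec0 k g h : recfun k g -> recfun k.+2 h ->
  recfun k.+1 (fun xs => prec_fun g h (nth 0 xs 0) (behead xs)).
Proof.
move=> [c oc Hc] [d od Hd]; exists (Prec c d) => [|[|n xs] //= [sx]]; first by rewrite /= oc.
set rec := fix rec (n y : nat) : Prop := _.
elim: n => [|n IH] y /=; first exact: Hc.
split=> [[z /IH -> /Hd-> //=]|->]; first by rewrite sx.
by exists (prec_fun g h n xs); [apply/IH | apply/Hd; rewrite /= ?sx].
Qed.

Lemma map_projs k (xs : seq nat) : size xs = k ->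
  [seq a xs | a : seq nat -> nat <- [seq (fun xs => nth 0 xs i) | i <- iota 0 k]] = xs.
Proof.
move=> <-; rewrite -map_comp; apply: (@eq_from_nth _ 0); rewrite size_map size_iota // => i lti.
by rewrite (nth_map 0) ?size_iota //= nth_iota.
Qed.

Lemma recfun_proj_nth k m i :
  recfun k (nth (fun=> 0) [seq (fun xs => nth 0 xs j) | j <- iota 0 m] i).
Proof.
case: (ltnP i m) => lti; last by rewrite nth_default ?size_map ?size_iota //; exists Zero.
by rewrite (nth_map 0) ?size_iota // nth_iota //; apply: recfun_nth.
Qed.

Lemma recfun_cons k phi a : recfun k.+1 phi -> recfun k a ->
  recfun k (fun xs => phi (a xs :: xs)).
Proof.
move=> Hp Ha.
have := @recfun_comp k k.+1 phi (a :: [seq (fun xs => nth 0 xs i) | i <- iota 0 k]).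
rewrite /= size_map size_iota => /(_ erefl Hp) H.
apply: recfun_ext (H _) => [xs sx|[|i] lti] //=; first by rewrite map_projs.
exact: recfun_proj_nth.
Qed.

Lemma recfun_behead k phi : recfun k phi -> recfun k.+1 (fun xs => phi (behead xs)).
Proof.
move=> Hp.
have := @recfun_comp k.+1 k phi [seq (fun xs => nth 0 xs i) | i <- iota 1 k].
rewrite size_map size_iota => /(_ erefl Hp) H.
apply: recfun_ext (H _) => [[|x xs] //= [sx]|i lti].
  rewrite -[in RHS](map_projs sx); congr phi; rewrite -!map_comp (iotaDl 1 0) -map_comp.
  exact: eq_map.
by rewrite (nth_map 0) ?size_iota //; apply: recfun_nth.
Qed.

Lemma recfun_prec k n g h : recfun k n -> recfun k g -> recfun k.+2 h ->
  recfun k (fun xs => prec_fun g h (n xs) xs).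
Proof. by move=> Hn Hg Hh; apply: (recfun_cons (recfun_prec0 Hg Hh) Hn). Qed.

Lemma recfun_succ k a : recfun k a -> recfun k (fun xs => (a xs).+1).
Proof.
by move=> Ha; apply: (@recfun_cons k (fun xs => (nth 0 xs 0).+1)) => //; exists Succ.
Qed.

Lemma recfun_const k n : recfun k (fun=> n).
Proof. by elim: n => [|n IH]; [exists Zero | exact: recfun_succ]. Qed.

Lemma recfun_add k a b : recfun k a -> recfun k b -> recfun k (fun xs => a xs + b xs).
Proof.
move=> Ha Hb; apply: recfun_ext (recfun_prec Hb Ha (recfun_succ (recfun_nth _ 1))) => xs _.
by elim: (b xs) => [|n IH] /=; rewrite ?addn0 // IH addnS.
Qed.

Lemma recfun_pred k a : recfun k a -> recfun k (fun xs => (a xs).-1).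
Proof.
move=> Ha; apply: recfun_ext (recfun_prec Ha (recfun_const k 0) (recfun_nth _ 0)) => xs _.
by case: (a xs).
Qed.

Lemma recfun_sub k a b : recfun k a -> recfun k b -> recfun k (fun xs => a xs - b xs).
Proof.
move=> Ha Hb; apply: recfun_ext (recfun_prec Hb Ha (recfun_pred (recfun_nth _ 1))) => xs _.
by elim: (b xs) => [|n IH] /=; rewrite ?subn0 // IH subnS.
Qed.

Lemma recfun_mul k a b : recfun k a -> recfun k b -> recfun k (fun xs => a xs * b xs).
Proof.
move=> Ha Hb.
apply: recfun_ext (recfun_prec Hb (recfun_const k 0)
  (recfun_add (recfun_nth _ 1) (recfun_behead (recfun_behead Ha)))) => xs _.
by elim: (b xs) => [|n IH] /=; rewrite ?muln0 // IH mulnS addnC.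
Qed.

Lemma recfun_exp k a b : recfun k a -> recfun k b -> recfun k (fun xs => a xs ^ b xs).
Proof.
move=> Ha Hb.
apply: recfun_ext (recfun_prec Hb (recfun_const k 1)
  (recfun_mul (recfun_behead (recfun_behead Ha)) (recfun_nth _ 1))) => xs _.
by elim: (b xs) => [|n IH] //=; rewrite IH expnS.
Qed.

Definition recpred (k : nat) (P : seq nat -> bool) : Prop :=
  recfun k (fun xs => nat_of_bool (P xs)).

Lemma recpred_leq k a b : recfun k a -> recfun k b -> recpred k (fun xs => a xs <= b xs).
Proof.
move=> Ha Hb; apply: recfun_ext (recfun_sub (recfun_const k 1) (recfun_sub Ha Hb)) => xs _.
by rewrite [a xs <= b xs]/leq; case: (a xs - b xs).
Qed.

Lemma recpred_and k P Q : recpred k P -> recpred k Q -> recpred k (fun xs => P xs && Q xs).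
Proof. by move=> HP HQ; apply: recfun_ext (recfun_mul HP HQ) => xs _; rewrite mulnb. Qed.

Lemma recpred_not k P : recpred k P -> recpred k (fun xs => ~~ P xs).
Proof.
by move=> HP; apply: recfun_ext (recfun_sub (recfun_const k 1) HP) => xs _; case: (P xs).
Qed.

Lemma recpred_or k P Q : recpred k P -> recpred k Q -> recpred k (fun xs => P xs || Q xs).
Proof.
move=> HP HQ; apply: recfun_ext (recpred_not (recpred_and (recpred_not HP) (recpred_not HQ))).
by move=> xs _; rewrite negb_and !negbK.
Qed.

Lemma recpred_imply k P Q : recpred k P -> recpred k Q -> recpred k (fun xs => P xs ==> Q xs).
Proof.
by move=> HP HQ; apply: recfun_ext (recpred_or (recpred_not HP) HQ) => xs _; rewrite implybE.
Qed.

Lemma recpred_eq k a b : recfun k a -> recfun k b -> recpred k (fun xs => a xs == b xs).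
Proof.
move=> Ha Hb; apply: recfun_ext (recpred_and (recpred_leq Ha Hb) (recpred_leq Hb Ha)).
by move=> xs _; rewrite -eqn_leq.
Qed.

Lemma recpred_const k (b : bool) : recpred k (fun=> b).
Proof. exact: recfun_const. Qed.

(** Inside a recursion the list holds the counter, then [j] auxiliary entries such as the
    accumulator, then the parameters. This hides the auxiliary entries from a body written for
    counter and parameters. *)
Lemma recfun_step j k a : recfun k.+1 a ->
  recfun (j + k).+1 (fun xs => a (nth 0 xs 0 :: iter j behead (behead xs))).
Proof.
move=> Ha; pose args := (fun xs : seq nat => nth 0 xs 0) ::
  [seq (fun xs => nth 0 xs i) | i <- iota j.+1 k].
have := @recfun_comp (j + k).+1 k.+1 a args.
rewrite /= size_map size_iota => /(_ erefl Ha) H.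
apply: recfun_ext (H _) => [[|x xs] //= [sx]|[|i] lti] /=; last 2 first.
- exact: recfun_nth.
- by rewrite (nth_map 0) ?size_iota //; apply: recfun_nth.
have sd : size (drop j xs) = k by rewrite size_drop sx addKn.
rewrite -drop_behead -[in RHS](map_projs sd); congr (a (_ :: _)).
rewrite -!map_comp -[j.+1]addn0 iotaDl -map_comp; apply: eq_map => i /=.
by rewrite nth_drop.
Qed.

Lemma recfun_sum k n a : recfun k n -> recfun k.+1 a ->
  recfun k (fun xs => \sum_(i < n xs) a (val i :: xs)).
Proof.
move=> Hn Ha.
apply: recfun_ext (recfun_prec Hn (recfun_const k 0)
  (recfun_add (recfun_nth _ 1) (@recfun_step 1 _ _ Ha))) => xs _.
by elim: (n xs) => [|m IH] /=; rewrite ?big_ord0 // big_ord_recr /= IH.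
Qed.

Lemma recfun_prod k n a : recfun k n -> recfun k.+1 a ->
  recfun k (fun xs => \prod_(i < n xs) a (val i :: xs)).
Proof.
move=> Hn Ha.
apply: recfun_ext (recfun_prec Hn (recfun_const k 1)
  (recfun_mul (recfun_nth _ 1) (@recfun_step 1 _ _ Ha))) => xs _.
by elim: (n xs) => [|m IH] /=; rewrite ?big_ord0 // big_ord_recr /= IH.
Qed.

Lemma recpred_all k n P : recfun k n -> recpred k.+1 P ->
  recpred k (fun xs => all (fun i => P (i :: xs)) (iota 0 (n xs))).
Proof.
move=> Hn HP; apply: recfun_ext (recfun_prod Hn HP) => xs _.
by rewrite (prodb_ord (n xs) (fun i => P (i :: xs))).
Qed.

Lemma recpred_has k n P : recfun k n -> recpred k.+1 P ->
  recpred k (fun xs => has (fun i => P (i :: xs)) (iota 0 (n xs))).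
Proof.
move=> Hn HP; apply: recfun_ext (recpred_not (recpred_all Hn (recpred_not HP))) => xs _.
by rewrite (all_predC (fun i => P (i :: xs))) negbK.
Qed.

(** The quotient is the number of [i < a xs] with [i.+1 * b xs <= a xs], which is a bounded sum. *)
Lemma recfun_div k a b : recfun k a -> recfun k b -> (forall xs, 0 < b xs) ->
  recfun k (fun xs => a xs %/ b xs).
Proof.
move=> Ha Hb b0.
apply: recfun_ext (recfun_sum Ha
  (recpred_leq (recfun_mul (recfun_succ (recfun_nth _ 0)) (recfun_behead Hb)) (recfun_behead Ha))).
move=> xs _ /=; move: (a xs) (b xs) (b0 xs) => m d d0.
suff E n : \sum_(i < n) (i.+1 * d <= m) = minn n (m %/ d).
  by rewrite E; apply/minn_idPr/leq_div.
elim: n => [|n IH]; first by rewrite big_ord0 min0n.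
rewrite big_ord_recr /= IH -leq_divRL //; move: (m %/ d) => q.
case: (ltnP n q) => h; first by rewrite (minn_idPl h) addn1.
by rewrite addn0 (minn_idPr _) // ltnW.
Qed.

Lemma recfun_mod k a b : recfun k a -> recfun k b -> (forall xs, 0 < b xs) ->
  recfun k (fun xs => a xs %% b xs).
Proof.
move=> Ha Hb b0; apply: recfun_ext (recfun_sub Ha (recfun_mul (recfun_div Ha Hb b0) Hb)) => xs _.
by rewrite {1}(divn_eq (a xs) (b xs)) addKn.
Qed.

Definition recargs k (args : seq (seq nat -> nat)) :=
  forall i, i < size args -> recfun k (nth (fun=> 0) args i).

Lemma recargs_behead k args : recargs k args ->
  recargs k.+1 [seq (fun xs => a (behead xs)) | a : seq nat -> nat <- args].
Proof.
move=> H i; rewrite size_map => lti; rewrite (nth_map (fun=> 0)) //.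
exact/recfun_behead/H.
Qed.

Lemma recargs_cons k a args : recfun k a -> recargs k args -> recargs k (a :: args).
Proof. by move=> Ha H [|i] // lti; apply: H. Qed.

Lemma recfun_nth_args k args i : recargs k args ->
  recfun k (fun xs => nth 0 [seq a xs | a : seq nat -> nat <- args] i).
Proof.
move=> H; case: (ltnP i (size args)) => lti.
  by apply: recfun_ext (H i lti) => xs _; rewrite (nth_map (fun=> 0)).
by apply: recfun_ext (recfun_const k 0) => xs _; rewrite nth_default ?size_map.
Qed.

(** Induction on the fixed program [c]. Bound, oracle and arguments all depend on the parameters
    [xs], because recursion and minimisation put counters in front of the list. *)
Lemma recfun_run c : forall k S (W : seq nat -> bool) args,
  recfun k S -> recpred k.+1 W -> recargs k args ->
  recfun k (fun xs => run (fun i => W (i :: xs)) (S xs) c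
    [seq a xs | a : seq nat -> nat <- args]).
Proof.
elim/program_nested_ind: c => [||i||g hs IHg IHhs|g h IHg IHh|g IHg] k S W args HS HW Hargs.
- exact: recfun_const.
- by apply/recfun_succ/recfun_succ/recfun_nth_args.
- by apply/recfun_succ/recfun_nth_args.
- apply: recfun_mul; first by apply/(recpred_leq _ HS)/recfun_succ/recfun_nth_args.
  by apply/recfun_succ/(recfun_cons HW)/recfun_nth_args.
- rewrite /=; apply: recfun_mul.
    elim: hs IHhs => [|h hs IH] IHhs.
      by apply: recfun_ext (recfun_const k 1) => xs _; rewrite big_nil.
    apply: recfun_ext (recfun_mul (recpred_leq (recfun_const k 1) (IHhs h _ _ _ _ _ HS HW Hargs))
      (IH _)) => [xs _||h' hh']; first by rewrite /= big_cons.
      by left.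
    by apply: IHhs; right.
  have := IHg k S W [seq (fun xs => (run (fun i => W (i :: xs)) (S xs) h
    [seq a xs | a : seq nat -> nat <- args]).-1) | h <- hs] HS HW.
  move=> H; apply: recfun_ext (H _) => [xs _|i]; first by rewrite -!map_comp.
  rewrite size_map => lti; rewrite (nth_map Zero) //; apply: recfun_pred.
  by apply: IHhs => //; apply: In_nth.
- pose n xs := nth 0 [seq a xs | a : seq nat -> nat <- args] 0.
  pose ev p (xs zs : seq nat) := run (fun i => W (i :: xs)) (S xs) p zs.
  pose tl xs := [seq a xs | a : seq nat -> nat <- behead args].
  pose R g h := prec_fun (fun xs => ev g xs (tl xs))
    (fun ys => let xs := behead (behead ys) in
      (0 < nth 0 ys 1) * ev h xs (nth 0 ys 0 :: (nth 0 ys 1).-1 :: tl xs)).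
  have Htl : recargs k (behead args).
    by case: args Hargs {n tl R} => [|a args] H // i lti; apply: (H i.+1).
  apply: (@recfun_ext _ (fun xs => R g h (n xs) xs)) => [xs _|].
    rewrite (run_prec _ _ g h _).2.2 -/(n xs) behead_map -/(tl xs).
    elim: (n xs) => [|m IH]; first by rewrite (run_prec _ _ g h xs).1.
    by rewrite (run_prec _ _ g h xs).2.1 -IH.
  apply: recfun_prec; [exact: recfun_nth_args | exact: IHg |].
  apply: recfun_mul; first by apply: recpred_leq; [exact: recfun_const | exact: recfun_nth].
  have := IHh k.+2 (fun ys => S (behead (behead ys)))
    (fun ys => W (nth 0 ys 0 :: iter 2 behead (behead ys)))
    [:: (fun ys => nth 0 ys 0), (fun ys => (nth 0 ys 1).-1) &
     [seq (fun xs => a (behead xs)) | a : seq nat -> nat <-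
     [seq (fun xs => a (behead xs)) | a : seq nat -> nat <- behead args]]].
  move=> H; apply: recfun_ext (H _ _ _) => [xs _|||].
  + by rewrite /ev /tl /= -!map_comp.
  + exact: recfun_behead (recfun_behead HS).
  + exact: (@recfun_step 2 _ _ HW).
  + apply: recargs_cons; first exact: recfun_nth.
    apply: recargs_cons; first exact/recfun_pred/recfun_nth.
    exact: recargs_behead (recargs_behead Htl).
- pose P (ys : seq nat) := run (fun i => W (i :: behead ys)) (S (behead ys)) g
    (nth 0 ys 0 :: [seq a (behead ys) | a : seq nat -> nat <- args]).
  have HP : recfun k.+1 P.
    have := IHg k.+1 (fun ys => S (behead ys))
      (fun ys => W (nth 0 ys 0 :: iter 1 behead (behead ys)))
      ((fun ys => nth 0 ys 0) :: [seq (fun xs => a (behead xs)) | a : seq nat -> nat <- args]).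
    move=> H; apply: recfun_ext (H _ _ _) => [xs _|||].
    + by rewrite /P /= -!map_comp.
    + exact: recfun_behead HS.
    + exact: (@recfun_step 1 _ _ HW).
    + by apply: recargs_cons; [exact: recfun_nth | exact: recargs_behead].
  have H1 : recpred k.+1 (fun ys => P ys != 1).
    by apply/recpred_not/recpred_eq => //; apply: recfun_const.
  pose y xs := \sum_(j < S xs) \prod_(i < j.+1) (P (val i :: xs) != 1).
  have Hy : recfun k y.
    have H2 := recfun_prod (recfun_succ (recfun_nth k.+1 0)) (@recfun_step 1 _ _ H1).
    exact: recfun_sum HS H2.
  apply: (@recfun_ext _ (fun xs =>
    (y xs < S xs) * (\prod_(i < y xs) (0 < P (val i :: xs))) * (y xs).+1)) => [//|].
  apply: recfun_mul; last exact: recfun_succ.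
  apply: recfun_mul; first exact: (recpred_leq (recfun_succ Hy) HS).
  apply: (recfun_prod Hy (recpred_leq (recfun_const _ 1) HP)).
Qed.

Lemma recpred_search (P : nat -> nat -> bool) :
  recpred 2 (fun xs => P (nth 0 xs 0) (nth 0 xs 1)) -> (forall n, exists s, P s n) ->
  exists2 h : nat -> nat, recfun 1 (fun xs => h (nth 0 xs 0)) & forall n, P (h n) n.
Proof.
move=> [c oc Hc] exP; exists (fun n => ex_minn (exP n)); last by move=> n; case: ex_minnP.
(* [Mu] looks for the value 0, hence the negation. *)
have [d od Hd] := recpred_not (ex_intro2 _ _ c oc Hc).
exists (Mu d) => // -[|n [|]] //= _ y; case: ex_minnP => m Pm minm.
have Hdi i v : halts_with set0 d [:: i; n] v <-> v = ~~ P i n by apply: Hd.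
split=> [[/Hdi Py Hi]|->].
  apply/eqP; rewrite eqn_leq minm ?andbT; last by case: (P y n) Py.
  by rewrite leqNgt; apply/negP => /Hi[v /Hdi]; rewrite Pm.
split=> [|i ltim]; first by apply/Hdi; rewrite Pm.
exists 0; apply/Hdi; case: (boolP (P i n)) => // /minm; lia.
Qed.

(** * Colourings under effectively checkable constraints *)

(** König's lemma for the tree [P] with finite levels [L]: a sequence with extensions of every
    length ([Q]) has a one-step extension of the same kind, and iterating the choice gives the
    branch. *)
Lemma koenig (T : eqType) (P : seq T -> Prop) (L : nat -> seq T) :
  (forall u x, P (rcons u x) -> P u /\ x \in L (size u)) ->
  (forall n, exists2 u, size u = n & P u) ->
  exists Z : nat -> T, forall n, P (mkseq Z n).
Proof.
move=> Pr Pn; pose Q u := forall n, exists2 w, size w = n & P (u ++ w).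
have Pcat u w : P (u ++ w) -> P u.
  elim/last_ind: w => [|w x IH]; first by rewrite cats0.
  by rewrite -rcons_cat => /Pr[/IH].
have Qnext u : Q u -> exists x, Q (rcons u x).
  move=> Qu; apply: contrapT => /forallNP noQ.
  (* Each entry [x] fails at some length, and failure persists at greater lengths, so one [N] serves
     for the whole finite list. *)
  have [N HN] : exists N, forall x, x \in L (size u) -> ~ exists2 w, size w = N & P (rcons u x ++ w).
    elim: (L (size u)) => [|x l [N HN]]; first by exists 0.
    have /existsNP[m Hm] := noQ x; exists (maxn N m) => y.
    have cut w k : k <= size w -> P (rcons u y ++ w) -> exists2 w', size w' = k & P (rcons u y ++ w').
      move=> kw Pw; exists (take k w); first exact: size_takel.
      by apply: (Pcat _ (drop k w)); rewrite -catA cat_take_drop.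
    rewrite inE => /orP[/eqP yx|yl] [w sw Pw].
      by apply: Hm; rewrite -yx; apply: cut Pw; rewrite sw leq_maxr.
    by apply: (HN y yl); apply: cut Pw; rewrite sw leq_maxl.
  have [[//|x w] [sw] Pw] := Qu N.+1.
  have Pw' : P (rcons u x ++ w) by rewrite cat_rcons.
  have [_ xL] := Pr _ _ (Pcat _ _ Pw').
  by apply: (HN x xL); exists w.
have /choice[nxt Hnxt] : forall u, exists x, Q u -> Q (rcons u x).
  move=> u.
  case: (pselect (Q u)) => [/Qnext[x Qx]|nQ]; first by exists x.
  have [[|x ?] // _ _] := Pn 1; exists x => //.
pose U n := iter n (fun u => rcons u (nxt u)) [::].
have QU n : Q (U n) by elim: n => [|n IH]; [move=> n; exact: Pn | exact: Hnxt].
exists (fun n => nxt (U n)) => n.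
suff -> : mkseq (fun n => nxt (U n)) n = U n.
  by have [[|//] _] := QU n 0; rewrite cats0.
by elim: n => [//|n IH]; rewrite mkseqS IH.
Qed.

Section ListPredicates.
Context {T : Type}.

Fixpoint AllP (P : T -> Prop) (s : seq T) : Prop :=
  if s is x :: s' then P x /\ AllP P s' else True.

Fixpoint PairP (r : T -> T -> Prop) (s : seq T) : Prop :=
  if s is x :: s' then AllP (r x) s' /\ PairP r s' else True.

Lemma AllP_impl (P Q : T -> Prop) s : (forall x, P x -> Q x) -> AllP P s -> AllP Q s.
Proof. by move=> PQ; elim: s => //= x s IH [/PQ ? /IH]. Qed.

Lemma AllP_all (P : T -> Prop) s : (forall x, P x) -> AllP P s.
Proof. by move=> HP; elim: s => //= x s IH. Qed.

Lemma AllP_and (P Q : T -> Prop) s : AllP P s -> AllP Q s -> AllP (fun x => P x /\ Q x) s.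
Proof. by elim: s => //= x s IH [Px Ps] [Qx Qs]; split=> //; apply: IH. Qed.

Lemma has_AllP (P : T -> Prop) s : AllP P s -> forall p : pred T, has p s -> exists2 x, P x & p x.
Proof. by move=> + p; elim: s => //= x s IH [Px /IH Ps] /orP[px|/Ps]; first exists x. Qed.

Lemma hasN_AllP (I : Type) (p : I -> pred T) s :
  (forall i, ~~ has (p i) s) -> AllP (fun x => forall i, ~~ p i x) s.
Proof.
elim: s => //= x s IH H; split=> [i|]; first by have := H i; rewrite negb_or => /andP[].
by apply: IH => i; have := H i; rewrite negb_or => /andP[].
Qed.

Lemma AllP_cat P s1 s2 : AllP P (s1 ++ s2) <-> AllP P s1 /\ AllP P s2.
Proof. by elim: s1 => [|x s1 IH] /=; [split=> // -[]|rewrite IH; tauto]. Qed.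

Lemma AllP_nth x0 P s : AllP P s <-> forall i, i < size s -> P (nth x0 s i).
Proof.
elim: s => [|x s IH] /=; first by split.
rewrite IH; split=> [[Px H] [|i] //|H]; first exact: H.
by split=> [|i lti]; [exact: (H 0) | exact: (H i.+1)].
Qed.

Lemma PairP_cat r s1 s2 :
  PairP r s1 -> PairP r s2 -> AllP (fun x => AllP (r x) s2) s1 -> PairP r (s1 ++ s2).
Proof.
move=> + H2; elim: s1 => //= x s1 IH [r1 H1] [r2 H12].
by split; [apply/AllP_cat | apply: IH].
Qed.

Lemma PairP_nth x0 r s i j : PairP r s -> i < j -> j < size s -> r (nth x0 s i) (nth x0 s j).
Proof.
elim: s i j => //= x s IH [|i] [|j] // [H /IH Hs] ij js; last exact: Hs.
by move/(AllP_nth x0): H => H; apply: H.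
Qed.

End ListPredicates.

Lemma AllP_mem (T : eqType) (P : T -> Prop) s : AllP P s <-> {in s, forall x, P x}.
Proof.
elim: s => [|x s IH] /=; first by split.
rewrite IH; split=> [[Px H] y|H]; first by rewrite inE => /orP[/eqP->|/H].
by split=> [|y ys]; apply: H; rewrite inE ?eqxx ?ys ?orbT.
Qed.

Lemma AllP_map (T U : Type) (g : U -> T) P s :
  AllP P [seq g x | x <- s] <-> AllP (fun x => P (g x)) s.
Proof. by elim: s => //= x s ->. Qed.

Lemma PairP_map (T U : Type) (r : T -> T -> Prop) (r' : U -> U -> Prop) (g : T -> U) s :
  (forall x y, r x y -> r' (g x) (g y)) -> PairP r s -> PairP r' (map g s).
Proof.
move=> H; elim: s => //= x s IH [rx /IH]; split=> //; apply/AllP_map.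
by apply: AllP_impl rx => y /H.
Qed.

Lemma AllP_filter_map (T : Type) (U : finType) (g : U -> T) (a : pred U) P :
  AllP P [seq g x | x <- enum U & a x] <-> forall x, a x -> P (g x).
Proof.
rewrite AllP_map AllP_mem; split=> H x; last by rewrite mem_filter => /andP[/H].
by move=> ax; apply: H; rewrite mem_filter ax mem_enum.
Qed.

(* An oracle computation that starts from the finite set [tF] and may query, at
   or beyond [tm], elements whose colour lies in [tS]. *)
Record test (C : Type) := Test {tS : pred C; tm : nat; tF : seq nat; tc : program}.

(* [Loc n0 alts]: on each block [n >= n0] one of the alternatives [alt] holds,
   where [(S, q) \in alt] asks that colours in [S] occupy a fraction at least
   [1 / q] of the block. *)
Inductive constr (C : Type) :=
| Loc of nat & seq (seq (pred C * nat))
| Pt of nat & pred C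
| Avoid of test C & nat & bool
| Consistent of test C.

(** * Coding finite sets and colourings by digits *)

Definition bit (e i : nat) : bool := (e %/ 2 ^ i) %% 2 == 1.

Lemma digits_code K (d : nat -> nat) s : (forall i, i < s -> d i < K) ->
  exists2 z, z < K ^ s & forall i, i < s -> (z %/ K ^ i) %% K = d i.
Proof.
elim: s d => [|s IH] d dK; first by exists 0.
have [|z zK Hz] := IH (fun i => d i.+1); first by move=> i lti; apply: dK.
have d0 := dK 0 isT; have K0 : 0 < K by case: K d0 {dK IH zK Hz}.
exists (z * K + d 0) => [|[|i] lti].
- by rewrite expnS; nia.
- by rewrite expn0 divn1 modnMDl modn_small.
by rewrite expnS divnMA divnMDl // (divn_small d0) addn0 Hz.
Qed.

Lemma bits_code (P : nat -> bool) s :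
  exists2 e, e < 2 ^ s & forall i, i < s -> bit e i = P i.
Proof.
have [|e es He] := @digits_code 2 (fun i => P i) s; first by move=> i _; case: (P i).
by exists e => // i lti; rewrite /bit He //; case: (P i).
Qed.

Lemma hasP_iota (P : nat -> bool) n :
  reflect (exists2 i, i < n & P i) (has P (iota 0 n)).
Proof.
apply: (iffP hasP) => -[i]; first by rewrite mem_iota => /= lti Pi; exists i.
by move=> lti Pi; exists i; rewrite ?mem_iota.
Qed.

Lemma allP_iota (P : nat -> bool) n :
  reflect (forall i, i < n -> P i) (all P (iota 0 n)).
Proof.
apply: (iffP allP) => H i; first by move=> lti; apply: H; rewrite mem_iota.
by rewrite mem_iota => /H.
Qed.

Lemma run_mono (O : nat -> bool) s s' c xs y :
  s <= s' -> run O s c xs = y.+1 -> run O s' c xs = y.+1.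
Proof. exact: run_ext. Qed.

Section Effective.
Variables (f : nat -> option bool) (cf : program) (b : nat).
Hypothesis f_cf : program_for set0 cf f.
Hypothesis b_gt1 : 1 < b.

Definition cnt (n : nat) (P : nat -> bool) : nat :=
  \sum_(x < b ^ n.+1) ((b ^ n <= x) && P x).

Definition bsize (n : nat) : nat := cnt n xpredT.

Lemma eq_cnt n P P' : (forall x, x < b ^ n.+1 -> P x = P' x) -> cnt n P = cnt n P'.
Proof. by move=> E; apply: eq_bigr => i _; rewrite E. Qed.

Section Colours.
Variable C : finType.
Implicit Types (Z : nat -> C) (T : test C) (Q : seq (constr C)).

Definition outputs T Z (x : nat) (v : bool) : Prop :=
  exists2 E : seq nat, {in E, forall i, (tm T <= i) && tS T (Z i)}
    & halts_with [set i | i \in tF T ++ E] (tc T) [:: x] v.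

Definition locb Z (n : nat) (alts : seq (seq (pred C * nat))) : bool :=
  has (all (fun Sq => bsize n <= Sq.2 * cnt n (fun x => Sq.1 (Z x)))) alts.

Definition hold Z (c : constr C) : Prop :=
  match c with
  | Loc n0 alts => forall n, n0 <= n -> locb Z n alts
  | Pt y D => D (Z y)
  | Avoid T x v => ~ outputs T Z x v
  | Consistent T => forall x v, outputs T Z x v -> f x <> Some (~~ v)
  end.

Definition models Z Q : Prop := AllP (hold Z) Q.

Definition sat Q : Prop := exists Z, models Z Q.

(** The stage [s] bounds both the added set, coded by the bits of [e], and the computation. *)
Definition outb s T Z x (v : bool) : bool :=
  has (fun e => all (fun i => bit e i ==> ((tm T <= i) && tS T (Z i))) (iota 0 s)
     && (run (fun i => (i \in tF T) || bit e i) s (tc T) [:: x] == v.+1))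
    (iota 0 (2 ^ s)).

(** Every constraint is a $\Pi^0_1$ condition, and this is its refutation at stage [s], reading [Z]
    only below [s]. In the last case the values 1 and 2 of [run] stand for the outputs false and
    true of [f]. *)
Definition viol s Z (c : constr C) : bool :=
  match c with
  | Loc n0 alts => has (fun n => [&& n0 <= n, b ^ n.+1 <= s & ~~ locb Z n alts]) (iota 0 s)
  | Pt y D => (y < s) && ~~ D (Z y)
  | Avoid T x v => outb s T Z x v
  | Consistent T => has (fun x =>
      (outb s T Z x true && (run (fun=> false) s cf [:: x] == 1))
      || (outb s T Z x false && (run (fun=> false) s cf [:: x] == 2))) (iota 0 s)
  end.

Lemma outb_mono s s' T Z Z' x v : s <= s' -> (forall i, i < s -> Z i = Z' i) ->
  outb s T Z x v -> outb s' T Z' x v.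
Proof.
move=> ss' ZZ' /hasP_iota[e es /andP[/allP_iota He /eqP re]].
have [e' es' He'] := bits_code (fun i => (i < s) && bit e i) s'.
apply/hasP_iota; exists e' => //; apply/andP; split.
  apply/allP_iota => i lti; apply/implyP; rewrite He' // => /andP[ltis bi].
  by rewrite -ZZ'; have := He i ltis; rewrite bi.
apply/eqP; apply: run_ext re => // i ltis.
by rewrite He' ?ltis // (leq_trans ltis).
Qed.

Lemma outputsP T Z x v : outputs T Z x v <-> exists s, outb s T Z x v.
Proof.
split=> [[E HE /run_halts[s Hs]]|[s /hasP_iota[e es /andP[/allP_iota He /eqP re]]]].
  have [e es He] := bits_code (fun i => i \in E) s.
  exists s; apply/hasP_iota; exists e => //; apply/andP; split.
    by apply/allP_iota => i lti; apply/implyP; rewrite He // => /HE.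
  apply/eqP; apply: run_ext Hs => // i lti; rewrite He //.
  by rewrite -mem_cat; apply/idP/idP => [/set_mem|H]; last exact: mem_set.
exists [seq i <- iota 0 s | bit e i].
  by move=> i; rewrite mem_filter mem_iota /= => /andP[bi /He]; rewrite bi.
apply/run_halts; exists s; apply: run_ext re => // i lti.
rewrite -[LHS]/((i \in tF T) || bit e i).
transitivity (i \in tF T ++ [seq i <- iota 0 s | bit e i]).
  by rewrite mem_cat mem_filter mem_iota /= lti andbT.
by apply/idP/idP => [H|/set_mem]; first exact: mem_set.
Qed.

Lemma f_run x v : f x = Some v <-> exists s, run (fun=> false) s cf [:: x] = v.+1.
Proof.
have E : halts_with set0 cf [:: x] v <-> exists s, run (fun=> false) s cf [:: x] = v.+1.
  by rewrite run_halts; split=> -[s Hs]; exists s; apply: run_ext Hs => // i _; rewrite in_set0.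
rewrite -E; split=> [fx|/f_cf[v' -> /eqP]]; first by apply/f_cf; exists v.
by case: v {E}; case: v'.
Qed.

Lemma locb_ext Z Z' n alts : (forall i, i < b ^ n.+1 -> Z i = Z' i) ->
  locb Z n alts = locb Z' n alts.
Proof.
move=> E; apply: eq_has => alt; apply: eq_all => Sq /=.
by rewrite (@eq_cnt n (fun x => Sq.1 (Z x)) (fun x => Sq.1 (Z' x))) // => x /E->.
Qed.

Lemma viol_mono s s' Z Z' c : s <= s' -> (forall i, i < s -> Z i = Z' i) ->
  viol s Z c -> viol s' Z' c.
Proof.
move=> ss' ZZ'; case: c => [n0 alts|y D|T x v|T] /=.
- move=> /hasP_iota[n ns /and3P[n0n bs nl]]; apply/hasP_iota; exists n.
    exact: leq_trans ns ss'.
  rewrite n0n (leq_trans bs ss') -(@locb_ext Z) // => i ltib.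
  by apply: ZZ'; apply: leq_trans bs.
- by move=> /andP[ys nS]; rewrite (leq_trans ys ss') -ZZ'.
- exact: outb_mono.
move=> /hasP_iota[x xs H]; apply/hasP_iota; exists x; first exact: leq_trans xs ss'.
case/orP: H => /andP[/(outb_mono ss' ZZ')-> /eqP/(run_mono ss')->]; by rewrite ?orbT.
Qed.

Lemma hold_viol Z c : hold Z c <-> forall s, ~~ viol s Z c.
Proof.
case: c => [n0 alts|y D|T x v|T] /=.
- split=> [H s|H n n0n].
    by apply/hasP_iota => -[n _ /and3P[/H-> _]].
  apply: contraT => nl; have /hasP_iota[] := H (b ^ n.+1); exists n.
    by apply: ltn_trans (ltn_expl _ b_gt1); rewrite ltnSn.
  by rewrite n0n nl leqnn.
- split=> [-> s|H]; first by rewrite andbF.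
  by have := H y.+1; rewrite ltnSn /= negbK.
- rewrite outputsP; split=> [H s|H [s os]]; last by have := H s; rewrite os.
  by apply/negP => os; apply: H; exists s.
split=> [H s|H x v /outputsP[s os] /f_run[u Hu]].
  apply/hasP_iota => -[x _ /orP[]/andP[os /eqP rs]].
    by apply: (H x true); [apply/outputsP; exists s | apply/f_run; exists s].
  by apply: (H x false); [apply/outputsP; exists s | apply/f_run; exists s].
pose w := maxn (maxn s u) x.+1.
have /hasP_iota[] := H w; exists x; first by rewrite leq_maxr.
have sw : s <= w by rewrite !leq_max leqnn.
have uw : u <= w by rewrite !leq_max leqnn orbT.

have := outb_mono sw (fun i _ => erefl (Z i)) os.
have := run_mono uw Hu.
by case: v {os Hu} => /= -> ->; rewrite ?orbT.
Qed.

Definition violQ s Z Q : bool := has (viol s Z) Q.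

Lemma models_viol Z Q : models Z Q <-> forall s, ~~ violQ s Z Q.
Proof.
elim: Q => [|c Q IH] /=; first by split.
rewrite /models /= -/(models Z Q) IH hold_viol; split=> [[H1 H2] s|H].
  by rewrite negb_or H1 H2.
by split=> s; have := H s; rewrite negb_or => /andP[].
Qed.

Lemma violQ_mono s s' Z Z' Q : s <= s' -> (forall i, i < s -> Z i = Z' i) ->
  violQ s Z Q -> violQ s' Z' Q.
Proof. by move=> ss' E; apply: sub_has => c; apply: viol_mono. Qed.

(** König's lemma on the finite colourings that are not refuted at the stage equal to their length.
    The default of [nth] is harmless, as stage [s] reads only positions below [s]. *)
Lemma compactness Q : (forall s, exists Z, ~~ violQ s Z Q) -> sat Q.
Proof.
move=> H; have [Z1 _] := H 0; pose c0 := Z1 0.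
have [u x Pu|s|Z HZ] := @koenig C (fun u => ~~ violQ (size u) (nth c0 u) Q) (fun=> enum C).
- rewrite mem_enum; split=> //; apply: contra Pu; rewrite size_rcons.
  by apply: violQ_mono => // i lti; rewrite nth_rcons lti.
- have [Z HZ] := H s; exists (mkseq Z s); first by rewrite size_mkseq.
  apply: contra HZ; rewrite size_mkseq.
  by apply: violQ_mono => // i lti; rewrite nth_mkseq.
exists Z; apply/models_viol => s; have := HZ s; rewrite size_mkseq; apply: contra.
by apply: violQ_mono => // i lti; rewrite nth_mkseq.
Qed.

(** * Recursiveness of refutation, and conflicting systems *)

Definition dec (c0 : C) (z i : nat) : C := nth c0 (enum C) ((z %/ #|C| ^ i) %% #|C|).

Lemma dec_code c0 Z s : exists2 z, z < #|C| ^ s & forall i, i < s -> dec c0 z i = Z i.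
Proof.
have [i _|z zs Hz] := @digits_code #|C| (fun i => index (Z i) (enum C)) s.
  by rewrite cardE index_mem mem_enum.
by exists z => // i lti; rewrite /dec Hz // nth_index // mem_enum.
Qed.

Lemma recpred_nth k D (l : seq C) c0 (P : pred C) : recfun k D ->
  recpred k (fun xs => P (nth c0 l (D xs))).
Proof.
elim: l D => [|c l IH] D HD.
  by apply: recfun_ext (recpred_const k (P c0)) => xs _; rewrite nth_nil.
apply: recfun_ext (recpred_or
  (recpred_and (recpred_eq HD (recfun_const k 0)) (recpred_const k (P c)))
  (recpred_and (recpred_leq (recfun_const k 1) HD) (IH _ (recfun_pred HD)))) => xs _.
by case: (D xs) => [|n] //=; rewrite orbF.
Qed.

Lemma recpred_dec k c0 Zc I (P : pred C) : recfun k Zc -> recfun k I ->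
  recpred k (fun xs => P (dec c0 (Zc xs) (I xs))).
Proof.
move=> HZ HI; have K0 : 0 < #|C| by apply/card_gt0P; exists c0.
apply: recpred_nth; apply: recfun_mod => //; last exact: recfun_const.
apply: recfun_div => // [|xs]; last by rewrite expn_gt0 K0.
by apply: recfun_exp => //; apply: recfun_const.
Qed.

Lemma recpred_bit k Ec I : recfun k Ec -> recfun k I ->
  recpred k (fun xs => bit (Ec xs) (I xs)).
Proof.
move=> HE HI; apply: recpred_eq; last exact: recfun_const.
apply: recfun_mod => //; last exact: recfun_const.
apply: recfun_div => // [|xs]; last by rewrite expn_gt0.
by apply: recfun_exp => //; apply: recfun_const.
Qed.

Lemma recpred_mem k D (l : seq nat) : recfun k D -> recpred k (fun xs => D xs \in l).
Proof.
move=> HD; elim: l => [|a l IH]; first exact: recpred_const.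
apply: recfun_ext (recpred_or (recpred_eq HD (recfun_const k a)) IH) => xs _.
by rewrite inE.
Qed.

Lemma recpred_hasl k (I : Type) (P : I -> seq nat -> bool) l :
  (forall i, recpred k (P i)) -> recpred k (fun xs => has (fun i => P i xs) l).
Proof. by move=> H; elim: l => [|i l IH]; [exact: recpred_const | exact: recpred_or]. Qed.

Lemma recpred_alll k (I : Type) (P : I -> seq nat -> bool) l :
  (forall i, recpred k (P i)) -> recpred k (fun xs => all (fun i => P i xs) l).
Proof. by move=> H; elim: l => [|i l IH]; [exact: recpred_const | exact: recpred_and]. Qed.

Lemma recfun_behead2 k phi : recfun k phi -> recfun k.+2 (fun xs => phi (behead (behead xs))).
Proof. by move=> H; apply: (recfun_behead (recfun_behead H)). Qed.

Lemma recpred_outb k c0 T v S Zc X : recfun k S -> recfun k Zc -> recfun k X ->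
  recpred k (fun xs => outb (S xs) T (dec c0 (Zc xs)) (X xs) v).
Proof.
move=> HS HZ HX.
pose Q zs := bit (nth 0 zs 1) (nth 0 zs 0) ==>
  ((tm T <= nth 0 zs 0) && tS T (dec c0 (Zc (behead (behead zs))) (nth 0 zs 0))).
pose W zs := (nth 0 zs 0 \in tF T) || bit (nth 0 zs 1) (nth 0 zs 0).
pose P ys := all (fun i => Q (i :: ys)) (iota 0 (S (behead ys))) &&
  (run (fun i => W (i :: ys)) (S (behead ys)) (tc T)
     [seq a ys | a : seq nat -> nat <- [:: (fun ys => X (behead ys))]] == v.+1).
have H2 := recfun_const _ 2.
apply: (@recpred_has k (fun xs => 2 ^ S xs) P); first exact: recfun_exp.
have HQ : recpred k.+2 Q.
  apply: recpred_imply; first by apply: recpred_bit; apply: recfun_nth.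
  apply: recpred_and; first by apply: recpred_leq; [exact: recfun_const | exact: recfun_nth].
  by apply: recpred_dec; [exact: recfun_behead2 | exact: recfun_nth].
apply: recpred_and; first exact: (recpred_all (recfun_behead HS) HQ).
apply: recpred_eq; last exact: recfun_const.
apply: recfun_run; first exact: recfun_behead.
  apply: recpred_or; first by apply/recpred_mem/recfun_nth.
  by apply: recpred_bit; apply: recfun_nth.
by move=> [|i] // _; apply: recfun_behead.
Qed.

Lemma recfun_cnt k N (P : seq nat -> bool) : recfun k N -> recpred k.+1 P ->
  recfun k (fun xs => cnt (N xs) (fun x => P (x :: xs))).
Proof.
move=> HN HP; have Hb := recfun_const _ b.
apply: (@recfun_sum k (fun xs => b ^ (N xs).+1)
  (fun ys => (b ^ N (behead ys) <= nth 0 ys 0) && P ys)).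
  exact: recfun_exp (Hb _) (recfun_succ HN).
apply: recpred_and => //; apply: recpred_leq; last exact: recfun_nth.
exact: recfun_exp (Hb _) (recfun_behead HN).
Qed.

Lemma recpred_locb k c0 alts N Zc : recfun k N -> recfun k Zc ->
  recpred k (fun xs => locb (dec c0 (Zc xs)) (N xs) alts).
Proof.
move=> HN HZ; apply: recpred_hasl => alt.
apply: (@recpred_alll k _ (fun Sq xs =>
  bsize (N xs) <= Sq.2 * cnt (N xs) (fun x => Sq.1 (dec c0 (Zc xs) x)))) => Sq.
apply: recpred_leq; first exact: (recfun_cnt HN (recpred_const _ true)).
apply: recfun_mul; first exact: recfun_const.
apply: (@recfun_cnt k N (fun ys => Sq.1 (dec c0 (Zc (behead ys)) (nth 0 ys 0)))) => //.
by apply: recpred_dec; [exact: recfun_behead | exact: recfun_nth].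
Qed.

Lemma recfun_run_cf k S X : recfun k S -> recfun k X ->
  recfun k (fun xs => run (fun=> false) (S xs) cf [:: X xs]).
Proof.
move=> HS HX; apply: (@recfun_run cf k S (fun=> false) [:: X]) => //; first exact: recpred_const.
by case.
Qed.

Lemma recpred_viol k (c0 : C) (c : constr C) S Zc : recfun k S -> recfun k Zc ->
  recpred k (fun xs => viol (S xs) (dec c0 (Zc xs)) c).
Proof.
move=> HS HZ; have Hc m n : recfun n (fun=> m) := recfun_const n m.
case: c => [n0 alts|y D|T x v|T].
- apply: (@recpred_has k S (fun ys => [&& n0 <= nth 0 ys 0,
    b ^ (nth 0 ys 0).+1 <= S (behead ys) & ~~ locb (dec c0 (Zc (behead ys))) (nth 0 ys 0) alts])) => //.
  apply: recpred_and; first exact: recpred_leq (Hc n0 _) (recfun_nth _ 0).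
  apply: recpred_and.
    exact: recpred_leq (recfun_exp (Hc b _) (recfun_succ (recfun_nth _ 0))) (recfun_behead HS).
  exact/recpred_not/(recpred_locb _ _ (recfun_nth _ 0))/recfun_behead.
- apply: recpred_and; first exact: recpred_leq (Hc y.+1 _) HS.
  exact/recpred_not/(recpred_dec _ _ HZ)/Hc.
- exact: recpred_outb.
- apply: (@recpred_has k S (fun ys =>
      (outb (S (behead ys)) T (dec c0 (Zc (behead ys))) (nth 0 ys 0) true
        && (run (fun=> false) (S (behead ys)) cf [:: nth 0 ys 0] == 1))
      || (outb (S (behead ys)) T (dec c0 (Zc (behead ys))) (nth 0 ys 0) false
        && (run (fun=> false) (S (behead ys)) cf [:: nth 0 ys 0] == 2)))) => //.
  have HS' := recfun_behead HS; have HZ' := recfun_behead HZ; have H0 := recfun_nth k.+1 0.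
  apply: recpred_or; (apply: recpred_and; first exact: recpred_outb).
    exact: recpred_eq (recfun_run_cf HS' H0) (Hc 1 _).
  exact: recpred_eq (recfun_run_cf HS' H0) (Hc 2 _).
Qed.

Hypothesis no_completion :
  ~ exists g : nat -> bool, completion f g /\ computable (as_partial g).

Definition safe Z Ts (x : nat) (v : bool) : Prop :=
  AllP (fun T => ~ outputs T Z x v) Ts.

(** If every [x] failed, then at every [x] some system would become unsatisfiable by avoiding some
    bit [v], which compactness reveals at a finite stage. The search for such a stage is computable
    and its [v] never contradicts [f], so it would yield a computable completion. Searching through
    all of [Qs] at once makes [x] common to the systems. *)
Lemma undecided (Qs : seq (seq (constr C))) (Ts : seq (test C)) :
  AllP sat Qs -> AllP (fun Q => forall Z, models Z Q -> AllP (fun T => hold Z (Consistent T)) Ts) Qs ->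
  exists x, AllP (fun Q => forall v,
    sat (Q ++ [seq Avoid T x v | T <- Ts])) Qs.
Proof.
move=> satQ consQ; apply: contrapT => /forallNP nox.
have [c0 _] : exists c0 : C, True.
  case: (Qs) satQ nox => [|Q Qs'] /=; first by move=> _ /(_ 0) [].
  by move=> [[Z _] _] _; exists (Z 0).
(* By stage [s], the colouring coded by [z] is refuted as a model of [Q], or it makes some test
   output [v] at [x]. *)
pose stuck s x v Q z := violQ s (dec c0 z) Q || has (fun T => outb s T (dec c0 z) x v) Ts.
pose decides s x v := has (fun Q => all (stuck s x v Q) (iota 0 (#|C| ^ s))) Qs.
have recdecides v : recpred 2 (fun xs => decides (nth 0 xs 0) (nth 0 xs 1) v).
  have H0 := recfun_nth 2 0; have H1 := recfun_nth 2 1.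
  apply: recpred_hasl => Q.
  apply: (@recpred_all 2 (fun xs => #|C| ^ nth 0 xs 0)
    (fun ys => stuck (nth 0 (behead ys) 0) (nth 0 (behead ys) 1) v Q (nth 0 ys 0))).
    exact: recfun_exp (recfun_const _ _) H0.
  have HB0 := recfun_behead H0; have HB1 := recfun_behead H1; have H := recfun_nth 3 0.
  apply: recpred_or; apply: recpred_hasl => c; first exact: recpred_viol.
  exact: recpred_outb.
have [x|h rech Hh] := @recpred_search (fun s x => decides s x true || decides s x false)
    (recpred_or (recdecides true) (recdecides false)).
  apply: contrapT => /forallNP nos; apply: (nox x).
  have /hasN_AllP : forall sv : nat * bool,
      ~~ has (fun Q => all (stuck sv.1 x sv.2 Q) (iota 0 (#|C| ^ sv.1))) Qs.
    move=> [s v]; apply/negP => H; apply: (nos s).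
    by rewrite -[has _ _]/(decides s x v) in H; case: v H => ->; rewrite ?orbT.
  apply: AllP_impl => Q HQ v; apply: compactness => s.
  have /allPn[z _ nstuck] := HQ (s, v); exists (dec c0 z).
  by rewrite /violQ has_cat has_map.
(* A model of the deciding system is never refuted, so one of its tests outputs [v] at [x], and
   [consQ] applies. *)
have decidesP s x v : decides s x v -> f x <> Some (~~ v).
  have /has_AllP H := (AllP_and satQ consQ).
  move=> /H[Q [[Z ZQ] cons] /allP Hstuck].
  have [z zs Hz] := dec_code c0 Z s.
  have := Hstuck z; rewrite mem_iota => /(_ zs) /orP[viols|].
    by have /negP[] := (models_viol Z Q).1 ZQ s; apply: violQ_mono viols.
  have /has_AllP HT := cons Z ZQ; move=> /HT[T holdT os].
  by apply: (holdT x v); apply/outputsP; exists s; apply: outb_mono os.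
apply: no_completion; exists (fun x => decides (h x) x true); split.
  move=> x v fx; case: (boolP (decides _ _ _)) => [/decidesP|nd]; first by rewrite fx; case: v {fx}.
  have := Hh x; rewrite (negbTE nd) => /decidesP; rewrite fx; by case: v {fx}.
have [c oc Hc] := recfun_cons (recdecides true) rech.
exists c => // n y; rewrite (Hc [:: n]) //=.
by split=> [->|[v [<-] ->]] //; exists (decides (h n) n true).
Qed.

Lemma models_cat Z Q Q' : models Z (Q ++ Q') <-> models Z Q /\ models Z Q'.
Proof. exact: AllP_cat. Qed.

(** A reservoir contained in those of a model of [Q] and of a model of [Q'] then yields no output at
    all at [x]. *)
Definition conflicting Ts Q Q' : Prop := exists x v,
  (forall Z, models Z Q -> safe Z Ts x v) /\ (forall Z, models Z Q' -> safe Z Ts x (~~ v)).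

(** For the common [x] of [undecided], double the list: one copy of each system avoids true at [x],
    the other avoids false. Systems from different halves conflict at [x]; within a half the old
    conflicts persist, since the models only become fewer. *)
Lemma conflicting_systems Q Ts k : sat Q ->
  (forall Z, models Z Q -> AllP (fun T => hold Z (Consistent T)) Ts) ->
  exists Qs, [/\ size Qs = 2 ^ k,
    AllP (fun Q' => sat Q' /\ forall Z, models Z Q' -> models Z Q) Qs & PairP (conflicting Ts) Qs].
Proof.
move=> satQ consQ; elim: k => [|k [Qs [sQs HQs sepQs]]]; first by exists [:: Q].
have [||x Hx] := @undecided Qs Ts; first by apply: AllP_impl HQs => Q' [].
  by apply: AllP_impl HQs => Q' [_ H] Z /H/consQ.
pose ext v Q' := Q' ++ [seq Avoid T x v | T <- Ts].
have extP v Z Q' : models Z (ext v Q') -> models Z Q' /\ safe Z Ts x v.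
  by rewrite models_cat => -[? /AllP_map].
have sepext v : PairP (conflicting Ts) (map (ext v) Qs).
  apply: (@PairP_map _ _ (conflicting Ts)) sepQs => Q1 Q2 [y [w [H1 H2]]].
  by exists y, w; split=> Z /extP[? _]; [exact: H1 | exact: H2].
exists (map (ext true) Qs ++ map (ext false) Qs); split.
- by rewrite size_cat !size_map sQs addnn -mul2n expnS.
- apply/AllP_cat; split; apply/AllP_map; apply: AllP_impl (AllP_and Hx HQs) => Q' [H [_ HQ]];
    by split=> [|Z /extP[/HQ]]; first exact: H.
- apply: PairP_cat => //; apply/AllP_map/AllP_all => Q1; apply/AllP_map/AllP_all => Q2.
  by exists x, true; split=> Z /extP[].
Qed.

End Colours.
End Effective.

(** * Counting in blocks *)

Section Blocks.
Variable b : nat.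
Hypothesis b_gt1 : 1 < b.
Implicit Types (n : nat) (P : nat -> bool).

Definition blk n x : bool := (b ^ n <= x) && (x < b ^ n.+1).

Lemma cnt_le n P P' : (forall x, blk n x -> P x -> P' x) -> cnt b n P <= cnt b n P'.
Proof.
move=> PP'; apply: leq_sum => x _; case: (leqP _ x) => //= nx.
by case Px: (P x) => //; rewrite PP' // /blk nx ltn_ord.
Qed.

Lemma cnt_split n P P1 P2 : (forall x, blk n x -> P1 x + P2 x <= P x) ->
  cnt b n P1 + cnt b n P2 <= cnt b n P.
Proof.
move=> H; rewrite /cnt -big_split; apply: leq_sum => x _; case: (leqP _ x) => //= nx.
by apply: H; rewrite /blk nx ltn_ord.
Qed.

Lemma cnt_bsize n P : cnt b n P <= bsize b n.
Proof. exact: cnt_le. Qed.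

Lemma cnt_gt0 n P : 0 < cnt b n P -> exists2 x, blk n x & P x.
Proof.
rewrite lt0n sum_nat_eq0 negb_forall => /existsP[x]; rewrite implyTb eqb0 negbK => /andP[nx Px].
by exists (val x) => //; rewrite /blk nx ltn_ord.
Qed.

Lemma cnt_full n P x : bsize b n <= cnt b n P -> blk n x -> P x.
Proof.
move=> full bx; apply: contraLR full => nPx; rewrite -ltnNge.
have := @cnt_split n xpredT P (pred1 x).
have -> : cnt b n (pred1 x) = 1.
  have [nx xb] := andP bx; rewrite /cnt (bigD1 (Ordinal xb)) //= nx eqxx big1 // => y.
  by rewrite -val_eqE /= => /negbTE->; rewrite andbF.
rewrite addn1; apply=> y _ /=; case: (eqVneq y x) => [->|]; first by rewrite (negbTE nPx).
by rewrite addn0; case: (P y).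
Qed.

Lemma bsize_gt0 n : 0 < bsize b n.
Proof.
have ltb : b ^ n < b ^ n.+1 by rewrite ltn_exp2l.
by rewrite /bsize /cnt (bigD1 (Ordinal ltb)) //= leqnn.
Qed.

Lemma blk_log n x : blk n x -> trunc_log b x = n.
Proof. by move=> /andP[nx xn]; apply: trunc_log_eq; rewrite ?nx. Qed.

Lemma log_blk x : 0 < x -> blk (trunc_log b x) x.
Proof. by move=> x0; rewrite /blk trunc_logP // trunc_log_ltn. Qed.

Lemma cnt_sum (I : Type) (r : seq I) n (F : I -> nat -> bool) :
  \sum_(i <- r) cnt b n (F i) = \sum_(x < b ^ n.+1 | b ^ n <= x) \sum_(i <- r) F i x.
Proof.
rewrite /cnt exchange_big [RHS]big_mkcond; apply: eq_bigr => x _ /=.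
by case: (leqP _ x) => //= _; rewrite big1.
Qed.

(* If every two of the [2q] sets met in less than [1 / (2q)^2] of the block,
   then by double counting they would cover more than the whole block. *)
Lemma pair_overlap (K : eqType) (s : seq K) n q (P : K -> nat -> bool) :
  uniq s -> size s = 2 * q -> 0 < q -> {in s, forall r, bsize b n <= q * cnt b n (P r)} ->
  exists r r', [/\ r \in s, r' \in s, r != r' &
    bsize b n <= (2 * q) * (2 * q) * cnt b n (fun x => P r x && P r' x)].
Proof.
move=> us ss q0 HP; apply: contrapT => no.
have small r r' : r \in s -> r' \in s -> r != r' ->
    (2 * q) * (2 * q) * cnt b n (fun x => P r x && P r' x) <= (bsize b n).-1.
  move=> rs r's rr'; rewrite -ltnS prednK ?bsize_gt0 // ltnNge; apply/negP => H.
  by apply: no; exists r, r'.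
pose D x := \sum_(r <- s) P r x.
have sumD : 2 * bsize b n <= \sum_(x < b ^ n.+1 | b ^ n <= x) D x.
  rewrite -cnt_sum -(leq_pmul2l q0) [leqRHS]big_distrr /=.
  have -> : q * (2 * bsize b n) = \sum_(r <- s) bsize b n.
    by rewrite big_const_seq count_predT iter_addn_0 ss; lia.
  by rewrite big_seq [leqRHS]big_seq; apply: leq_sum.
have sumDD : \sum_(x < b ^ n.+1 | b ^ n <= x) D x * D x =
    \sum_(x < b ^ n.+1 | b ^ n <= x) D x +
    \sum_(r <- s) \sum_(r' <- s | r != r') cnt b n (fun x => P r x && P r' x).
  rewrite -(cnt_sum s n P) -big_split /=.
  have -> : \sum_(x < b ^ n.+1 | b ^ n <= x) D x * D x =
      \sum_(r <- s) \sum_(r' <- s) cnt b n (fun x => P r x && P r' x).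
    under [RHS]eq_bigr => r _ do rewrite (cnt_sum s n (fun r' x => P r x && P r' x)).
    rewrite exchange_big /=; apply: eq_bigr => x _; rewrite /D big_distrl /=.
    apply: eq_bigr => r _; rewrite big_distrr /=; apply: eq_bigr => r' _.
    by rewrite mulnb.
  rewrite big_seq [RHS]big_seq; apply: eq_bigr => r rs.
  rewrite (bigD1_seq r) //=; congr (_ + _).
    by apply: eq_cnt => x _; rewrite andbb.
  by apply: eq_bigl => r'; rewrite eq_sym.
have pairs : \sum_(r <- s) \sum_(r' <- s | r != r') cnt b n (fun x => P r x && P r' x)
    <= (bsize b n).-1.
  have q2 : 0 < (2 * q) * (2 * q) by lia.
  rewrite -(leq_pmul2l q2) big_distrr /=.
  have -> : (2 * q) * (2 * q) * (bsize b n).-1 = \sum_(r <- s) \sum_(r' <- s) (bsize b n).-1.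
    by rewrite !big_const_seq !count_predT !iter_addn_0 ss; lia.
  rewrite big_seq [leqRHS]big_seq; apply: leq_sum => r rs; rewrite big_distrr /=.
  rewrite big_mkcond big_seq [leqRHS]big_seq; apply: leq_sum => r' r's.
  by case: ifP => // rr'; apply: small.
(* Since [2 * D x <= D x * D x + 1], summing and inserting [sumDD] and [pairs] bounds the sum of [D]
   by twice the block size minus 1, against [sumD]. *)
have : \sum_(x < b ^ n.+1 | b ^ n <= x) (D x + D x) <=
    \sum_(x < b ^ n.+1 | b ^ n <= x) (D x * D x + 1).
  by apply: leq_sum => x _; case: (D x) => [|[|m]] //; nia.
have -> : \sum_(x < b ^ n.+1 | b ^ n <= x) (D x * D x + 1) =
    \sum_(x < b ^ n.+1 | b ^ n <= x) D x * D x + bsize b n.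
  rewrite big_split /=; congr (_ + _); rewrite /bsize /cnt big_mkcond.
  by apply: eq_bigr => x _; rewrite andbT.
rewrite big_split /= sumDD.
have := bsize_gt0 n; move: sumD pairs; set u := \sum_(x < _ | _) D x.
set w := \sum_(r <- s) _; set z := bsize b n; lia.
Qed.

(* Side [j] gets the share [2^-(j+1)], and these shares add up to less than 1. *)
Lemma heavy_side n d t (P : nat -> bool) (side : nat -> nat) :
  (forall x, blk n x -> side x <= t) -> bsize b n <= d * cnt b n P ->
  exists2 j, j <= t &
    bsize b n <= d * 2 ^ j.+1 * cnt b n (fun x => (side x == j) && P x).
Proof.
move=> sidet HP; apply: contrapT => no; pose c j := cnt b n (fun x => (side x == j) && P x).
have B0 := bsize_gt0 n; set B := bsize b n in HP no B0.
have light j : j <= t -> d * 2 ^ j.+1 * c j <= B.-1.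
  move=> jt; rewrite -ltnS prednK // ltnNge; apply/negP => H; by apply: no; exists j.
have total : cnt b n P <= \sum_(j <- iota 0 t.+1) c j.
  have inT x : blk n x -> side x \in iota 0 t.+1 by move=> /sidet; rewrite mem_iota ltnS.
  have := iota_uniq 0 t.+1; move: (iota _ _) inT => T inT uT.
  rewrite cnt_sum /cnt [leqRHS]big_mkcond; apply: leq_sum => x _ /=.
  case: (leqP _ x) => //= nx; case Px: (P x) => //=.
  have xT : side x \in T by apply: inT; rewrite /blk nx ltn_ord.
  by rewrite (bigD1_seq (side x) xT uT) /= eqxx.
(* The integer form of $\sum_{j<k} 2^{-(j+1)} = 1 - 2^{-k}$. *)
have partial k : k <= t.+1 -> d * (\sum_(j <- iota 0 k) c j) * 2 ^ k <= B.-1 * (2 ^ k).-1.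
  elim: k => [|k IH] kt; first by rewrite big_nil muln0.
  rewrite -addn1 iotaD big_cat big_seq1 /= add0n addn1.
  have := IH (ltnW kt); have := light k kt; have : 0 < 2 ^ k by rewrite expn_gt0.
  rewrite expnS; set S := \sum_(_ <- _) _; move: (c k) (2 ^ k) => u p; nia.
have := partial _ (leqnn _); have : 0 < 2 ^ t.+1 by rewrite expn_gt0.
have BS : B <= d * \sum_(j <- iota 0 t.+1) c j by rewrite (leq_trans HP) // leq_mul2l total orbT.
move: BS; move: (d * _) (2 ^ t.+1) => v p Bv p0 vp.
have : B * p <= v * p by rewrite leq_mul2r Bv orbT.
nia.
Qed.

End Blocks.

(** * Forcing *)

(** An embedding into the countable type of trees, in order to enumerate the programs as
    requirements. *)
Fixpoint program_tree (c : program) : GenTree.tree nat :=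
  match c with
  | Zero => GenTree.Node 0 [::]
  | Succ => GenTree.Node 1 [::]
  | Proj i => GenTree.Node 2 [:: GenTree.Leaf i]
  | Oracle => GenTree.Node 3 [::]
  | Comp g hs => GenTree.Node 4 (program_tree g :: [seq program_tree h | h <- hs])
  | Prec g h => GenTree.Node 5 [:: program_tree g; program_tree h]
  | Mu g => GenTree.Node 6 [:: program_tree g]
  end.

Fixpoint tree_program (u : GenTree.tree nat) : program :=
  match u with
  | GenTree.Node 1 _ => Succ
  | GenTree.Node 2 [:: GenTree.Leaf i] => Proj i
  | GenTree.Node 3 _ => Oracle
  | GenTree.Node 4 (v :: vs) => Comp (tree_program v) [seq tree_program w | w <- vs]
  | GenTree.Node 5 [:: v; w] => Prec (tree_program v) (tree_program w)
  | GenTree.Node 6 [:: v] => Mu (tree_program v)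
  | _ => Zero
  end.

Lemma program_treeK : cancel program_tree tree_program.
Proof.
elim/program_nested_ind => //= [g hs -> IH|g h -> -> //|g -> //].
congr Comp; elim: hs IH => //= h hs IHhs IH; rewrite IH; last by left.
by rewrite IHhs // => h' hh'; apply: IH; right.
Qed.

Definition prog (k : nat) : program :=
  if unpickle k is Some u then tree_program u else Zero.

Lemma prog_surj c : exists k, prog k = c.
Proof. by exists (pickle (program_tree c)); rewrite /prog pickleK program_treeK. Qed.

Definition unbounded (P : nat -> Prop) : Prop := forall n, exists2 i, n <= i & P i.

Lemma unbounded_infinite (B : set nat) : unbounded B -> infinite_set B.
Proof.
move=> uB /finite_fsetP[X BX].
have [i] := uB (\max_(x <- finmap.enum_fset X) x).+1.
rewrite BX /= => lti Xi.
have := @leq_bigmax_seq _ (finmap.enum_fset X) xpredT id i Xi isT.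
by rewrite leqNgt lti.
Qed.

(* A side of the construction: stem [nF], a bound [nm] on the stem, the number
   [ne] of requirements met so far, and the class [nR] of possible reservoirs. *)
Record node := Node {nF : seq nat; nm : nat; ne : nat; nR : set (set nat)}.

Lemma has_filter_map (T : Type) (U : finType) (g : U -> T) (a : pred U) (p : pred T) :
  reflect (exists2 c, a c & p (g c)) (has p [seq g c | c <- enum U & a c]).
Proof.
rewrite has_map; apply: (iffP hasP) => -[c]; first by rewrite mem_filter => /andP[ac _] pc; exists c.
by move=> ac pc; exists c => //; rewrite mem_filter ac mem_enum.
Qed.

Lemma AllP_flatten (T : Type) (P : T -> Prop) ss : AllP P (flatten ss) <-> AllP (AllP P) ss.
Proof. by elim: ss => //= u ss IH; rewrite AllP_cat IH. Qed.

Lemma choice2 (X Y : Type) (P Q : X -> Y -> Prop) :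
  (forall x, exists2 y, P x y & Q x y) ->
  exists2 h : X -> Y, forall x, P x (h x) & forall x, Q x (h x).
Proof.
move=> H; have /choice[h Hh] : forall x, exists y, P x y /\ Q x y.
  by move=> x; have [y] := H x; exists y.
by exists h => x; have [] := Hh x.
Qed.

Definition pull_test (C' C : Type) (phi : C' -> C) (T : test C) : test C' :=
  Test (fun c => tS T (phi c)) (tm T) (tF T) (tc T).

Definition pull (C' C : Type) (phi : C' -> C) (c : constr C) : constr C' :=
  match c with
  | Loc n0 alts => Loc n0
      [seq [seq ((fun c' => Sq.1 (phi c')) : pred C', Sq.2) | Sq : pred C * nat <- alt]
         | alt <- alts]
  | Pt y D => Pt y (fun c' => D (phi c'))
  | Avoid T x v => Avoid (pull_test phi T) x v
  | Consistent T => Consistent (pull_test phi T)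
  end.

Lemma models_pull (C' C : finType) (phi : C' -> C) f b (Z : nat -> C') (Q : seq (constr C)) :
  models f b Z [seq pull phi c | c <- Q] <-> models f b (fun i => phi (Z i)) Q.
Proof.
rewrite /models AllP_map.
have E c : hold f b Z (pull phi c) <-> hold f b (fun i => phi (Z i)) c.
  case: c => // n0 alts; rewrite /= /locb; split=> H n /H; rewrite has_map => Hn.
    by move: Hn; congr (has _ _); apply: funext => alt; rewrite /= all_map.
  by move: Hn; congr (has _ _); apply: funext => alt; rewrite /= all_map.
by split; apply: AllP_impl => c /E.
Qed.

(* A label [(h, j)] consists of the history [h] of a block, most recent split
   first, and a side [j]. Side [0] is the initial one, and the split at stage [t],
   recorded as [(parent side, r, r')] where [r] and [r'] are the two overlapping
   candidates, creates side [t.+1]. *)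
Notation label := (seq (nat * nat * nat) * nat)%type.

(** * Colours and labels after a split *)

Section Split.
Variables (C : finType) (L : C -> label) (M t : nat).

(* The colour [(g, (c, r, r'))] records [M] systems with candidates [g], and
   that on the present block the candidates [r] and [r'] overlap in the side of [c]. *)
Definition split_colour : finType := ({ffun 'I_M -> C * bool} * (C * 'I_M * 'I_M))%type.

Definition overlap (g : {ffun 'I_M -> C * bool}) p (r r' : 'I_M) : bool :=
  [&& r != r', L (g r).1 == p, (g r).2, L (g r').1 == p & (g r').2].

Definition new_history (a : C * 'I_M * 'I_M) : seq (nat * nat * nat) :=
  ((L a.1.1).2, val a.1.2, val a.2) :: (L a.1.1).1.

(* Colours outside the announced history are junk; they occur in no late block. *)
Definition new_label (w : split_colour) : label :=
  let: c := w.2.1.1 in let: r := w.2.1.2 in let: r' := w.2.2 in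
  if ((L (w.1 r).1).1 == (L c).1) && ((L (w.1 r).1).2 <= t)
  then (new_history w.2, if overlap w.1 (L c) r r' then t.+1 else (L (w.1 r).1).2)
  else ([::], 0).

Lemma new_labelP w al h i : new_label w = (al :: h, i) -> exists r r' : 'I_M,
  [/\ al = (al.1.1, val r, val r'), (L (w.1 r).1).1 = h, (L (w.1 r).1).2 <= t &
    i = if overlap w.1 (h, al.1.1) r r' then t.+1 else (L (w.1 r).1).2].
Proof.
rewrite /new_label; case: ifP => // /andP[/eqP hr st] [<- <- <-].
by exists w.2.1.2, w.2.2; rewrite /= -surjective_pairing hr.
Qed.

(** Each candidate is dense in the side of some good colour. By pigeonhole at least [K] of the [M]
    candidates choose the same [c], and [2 * q] of these go into [pair_overlap]. *)
Lemma candidates_overlap b (d : nat) (gd : pred C) (Z : 'I_M -> nat -> C * bool) n K :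
  1 < b -> 0 < d -> 0 < M -> (forall c, 2 * (d * 2 ^ (L c).2.+1) <= K) -> #|C| * K <= M ->
  (forall r, exists2 c, gd c & bsize b n <= d * 2 ^ (L c).2.+1 *
     cnt b n (fun x => (L (Z r x).1 == L c) && (Z r x).2)) ->
  exists a : C * 'I_M * 'I_M, gd a.1.1 /\
    bsize b n <= 2 * (d * 2 ^ (L a.1.1).2.+1) * (2 * (d * 2 ^ (L a.1.1).2.+1)) *
      cnt b n (fun x => overlap [ffun r => Z r x] (L a.1.1) a.1.2 a.2).
Proof.
move=> b1 d0 M0 HK CM /choice2[cr gdr Hr].
have [c cK] : exists c, K <= #|[pred r | cr r == c]|.
  apply: contrapT => /forallNP H.
  have : \sum_(c : C) #|[pred r | cr r == c]| < M.
    apply: leq_trans CM; rewrite -sum_nat_const.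
    have c0 := cr (Ordinal M0); rewrite (bigD1 c0) // [ltnRHS](bigD1 c0) //= -addSn.
    apply: leq_add; first by rewrite ltnNge; apply/negP.
    by apply: leq_sum => c _; apply: ltnW; rewrite ltnNge; apply/negP.
  suff -> : \sum_(c : C) #|[pred r | cr r == c]| = M by rewrite ltnn.
  rewrite -[RHS]card_ord -sum1_card (partition_big cr xpredT) //=; apply: eq_bigr => c _.
  by rewrite -sum1_card; apply: eq_bigl.
pose q := d * 2 ^ (L c).2.+1; have q0 : 0 < q by rewrite muln_gt0 d0 expn_gt0.
pose s := take (2 * q) (enum [pred r | cr r == c]).
have sP r : r \in s -> cr r = c by move=> /mem_take; rewrite mem_enum inE => /eqP.
have [|||r rs|r [r' [rs r's rr' H]]] := @pair_overlap b b1 _ s n q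
    (fun r x => (L (Z r x).1 == L c) && (Z r x).2).
- exact/take_uniq/enum_uniq.
- by rewrite size_takel // -cardE; apply: leq_trans cK; apply: HK.
- exact: q0.
- by have := Hr r; rewrite (sP r rs).
exists (c, r, r'); split=> /=; first by rewrite -(sP r rs).
apply: leq_trans H _; rewrite leq_mul2l; apply/orP; right; apply: cnt_le => x _.
by rewrite /overlap !ffunE rr' /= -!andbA.
Qed.

End Split.

(** * Conditions, their extension, and saturation *)

Section Forcing.
Variables (f : nat -> option bool) (cf : program).
Hypothesis f_cf : program_for set0 cf f.
Hypothesis no_completion :
  ~ exists g : nat -> bool, completion f g /\ computable (as_partial g).
Variables (b nA d : nat) (A : set nat).
Hypothesis b_gt1 : 1 < b.
Hypothesis A_dense : forall n, nA <= n -> bsize b n <= d * cnt b n (fun x => x \in A).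
Hypothesis subsets_compute : forall B : set nat, B `<=` A -> infinite_set B ->
  exists g : nat -> bool, completion f g /\ computes B (as_partial g).

Implicit Types (nu : node) (R : set nat) (E : seq nat).

(* At [x], the functional either gives no output or contradicts [f]. *)
Definition settled (k : nat) nu : Prop := exists x, forall R, nR nu R ->
  forall E (v : bool), {in E, forall i, nm nu <= i /\ R i} ->
  halts_with [set i | i \in nF nu ++ E] (prog k) [:: x] v -> f x = Some (~~ v).

Definition valid nu : Prop :=
  {in nF nu, forall i, A i /\ i < nm nu} /\ forall k, k < ne nu -> settled k nu.

(** As for Mathias conditions. A single [R] has to contain both the new stem elements and the rest
    of [R'], so that computations from [nu'] are computations from [nu]. *)
Definition extends nu' nu : Prop := exists E,
  [/\ nF nu' = nF nu ++ E, nm nu <= nm nu', {in E, forall i, nm nu <= i}, ne nu <= ne nu' &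
    forall R', nR nu' R' ->
      exists2 R, nR nu R & forall i, i \in E \/ (R' i /\ nm nu' <= i) -> R i].

Definition good nu : Prop := exists2 R, nR nu R & unbounded (fun i => A i /\ R i).

(** The stem element [y] will make the final set infinite. The second clause, that the next
    requirement cannot be met by contradicting [f], makes [(X, A)] a candidate. *)
Definition saturated nu : Prop := good nu ->
  (exists2 y, y \in nF nu & ne nu <= y) /\
  forall R, nR nu R -> forall E x (v : bool), {in E, forall i, [/\ nm nu <= i, R i & A i]} ->
    halts_with [set i | i \in nF nu ++ E] (prog (ne nu)) [:: x] v -> f x <> Some (~~ v).

Lemma extends_refl nu : extends nu nu.
Proof. by exists [::]; rewrite cats0; split=> // R HR; exists R => // i [|[]]. Qed.

Lemma extends_trans nu2 nu1 nu3 : extends nu1 nu2 -> extends nu2 nu3 -> extends nu1 nu3.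
Proof.
move=> [E1 [F1 m1 H1 e1 R1]] [E2 [F2 m2 H2 e2 R2]]; exists (E2 ++ E1); split.
- by rewrite F1 F2 catA.
- exact: leq_trans m1.
- by move=> i; rewrite mem_cat => /orP[/H2|/H1] // /(leq_trans m2).
- exact: leq_trans e1.
move=> R' /R1[R HR HRi]; have [S HS HSi] := R2 R HR; exists S => // i; rewrite mem_cat.
case=> [/orP[iE2|iE1]|Ri]; apply: HSi; [by left|right|right].
  by split; [apply: HRi; left | exact: H1].
by split; [apply: HRi; right | case: Ri => _ /(leq_trans m1)].
Qed.

Lemma good_extends nu' nu : extends nu' nu -> good nu' -> good nu.
Proof.
move=> [E [_ _ _ _ HR]] [R' /HR[R nR HRi] uR']; exists R => // n.
have [i] := uR' (maxn n (nm nu')); rewrite geq_max => /andP[ni mi] [Ai R'i].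
by exists i => //; split=> //; apply: HRi; right.
Qed.

Lemma settled_extends k nu' nu : extends nu' nu -> settled k nu -> settled k nu'.
Proof.
move=> [E [HF mm HE _ HR]] [x Hx]; exists x => R' /HR[R nR HRi] E' v HE'.
rewrite HF -catA; apply: (Hx R nR) => i; rewrite mem_cat => /orP[iE|/HE'[mi R'i]].
  by split; [exact: HE | apply: HRi; left].
by split; [exact: leq_trans mi | apply: HRi; right].
Qed.

(** The union [B] of the stems is an infinite subset of [A], so some program [prog k] computes a
    completion [g] from it. At the [x] where requirement [k] is settled, the use of this computation
    lies in a later stem, whose new elements come from a reservoir of the earlier node. Hence [f x]
    is the opposite of [g x]. *)
Lemma no_chain (nu : nat -> node) :
  (forall i, extends (nu i.+1) (nu i)) -> (forall i, valid (nu i)) ->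
  (forall i, exists R, nR (nu i) R) ->
  (forall k, exists2 i, k < ne (nu i) & exists2 y, y \in nF (nu i) & k <= y) -> False.
Proof.
move=> ext val ne0 big.
have ext_le i j : i <= j -> extends (nu j) (nu i).
  move=> /subnK <-; elim: (j - i) => [|n IH]; first exact: extends_refl.
  exact: extends_trans (ext _) IH.
pose B : set nat := [set x | exists i, x \in nF (nu i)].
have [|| g [gf [c gc]]] := subsets_compute (B := B).
- by move=> x [i /(val i).1[]].
- apply: unbounded_infinite => n; have [i _ [y yF ny]] := big n.
  by exists y => //; exists i.
have [k kc] := prog_surj c; have [i ki _] := big k.
have [x Hx] := (val i).2 k ki.
have Bc : halts_with B c [:: x] (g x) by apply/gc; exists (g x).
have [u Hu] := halts_use Bc.
have [j ij Hj] : exists2 j, i <= j & forall y, y < u -> B y -> y \in nF (nu j).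
  elim: u {Hu} => [|u [j ij Hj]]; first by exists i.
  have inF y j' : j <= j' -> y \in nF (nu j) -> y \in nF (nu j').
    by move=> /ext_le[E [-> _ _ _ _]] yj; rewrite mem_cat yj.
  case: (pselect (B u)) => [[l Hl]|nBu].
    exists (maxn j l) => [|y]; first by rewrite leq_max ij.
    rewrite ltnS leq_eqVlt => /orP[/eqP-> _|yu /(Hj y yu)]; last by apply: inF; apply: leq_maxl.
    by have [E [-> _ _ _ _]] := ext_le _ _ (leq_maxr j l); rewrite mem_cat Hl.
  exists j => // y; rewrite ltnS leq_eqVlt => /orP[/eqP-> //|]; exact: Hj.
have [E [HF mm HE _ HR]] := ext_le _ _ ij.
have [R' /HR[R nR HRi]] := ne0 j.
have fx : f x = Some (~~ g x).
  apply: (Hx R nR E) => [y yE|]; first by split; [exact: HE | apply: HRi; left].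
  by rewrite kc -HF; apply: Hu => y yu; split=> [|yj]; [exact: Hj | exists j].
by have := gf _ _ fx; case: (g x).
Qed.

Definition mknode (C : finType) (Q : seq (constr C)) (S : pred C) (F : seq nat) (m e : nat) :=
  Node F m e [set R | exists2 Z : nat -> C, models f b Z Q & R = [set i | S (Z i)]].

Definition big_stem nu : Prop := exists2 y, y \in nF nu & ne nu <= y.

Lemma mknode_ex (C : finType) (Q : seq (constr C)) S F m e :
  sat f b Q -> exists R, nR (mknode Q S F m e) R.
Proof. by move=> [Z HZ]; exists [set i | S (Z i)]; exists Z. Qed.

Lemma models_points (C : finType) (Z : nat -> C) (S : pred C) E :
  models f b Z [seq Pt i S | i <- E] <-> {in E, forall i, S (Z i)}.
Proof. by rewrite /models AllP_map AllP_mem. Qed.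

(** New stem elements are kept in the side by [Pt] constraints. If the stem is big, non-saturation
    provides a computation contradicting [f], which settles requirement [e]; otherwise a reservoir
    meeting [A] infinitely often provides a large stem element. *)
Lemma progress (C : finType) (Q : seq (constr C)) (S : pred C) F m e :
  let nu := mknode Q S F m e in sat f b Q -> valid nu -> ~ saturated nu ->
  exists Q1 F1 m1 e1, let nu1 := mknode (Q1 ++ Q) S F1 m1 e1 in
    [/\ sat f b (Q1 ++ Q), valid nu1, extends nu1 nu &
      if `[< big_stem nu >] then e1 = e.+1 else e1 = e /\ big_stem nu1].
Proof.
move=> nu satQ [vF vs] /not_implyP[[R nuR uR] nsat].
have grow E m1 Z : models f b Z Q -> {in E, forall i, [/\ m <= i, S (Z i) & A i]} ->
    m <= m1 -> {in E, forall i, i < m1} ->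
    [/\ sat f b ([seq Pt i S | i <- E] ++ Q),
       {in F ++ E, forall i, A i /\ i < m1} &
       forall e1, e <= e1 -> extends (mknode ([seq Pt i S | i <- E] ++ Q) S (F ++ E) m1 e1) nu].
  move=> HZ HE mm Em; split.
  - by exists Z; apply/models_cat; split=> //; apply/models_points => i /HE[].
  - move=> i; rewrite mem_cat => /orP[/vF[Ai im]|iE]; first by split=> //; apply: leq_trans mm.
    by split; [have [] := HE i iE | exact: Em].
  move=> e1 ee1; exists E; split=> // [i /HE[]//|R' [Z' /models_cat[/models_points HP HQ] ->]].
  by exists [set i | S (Z' i)]; [exists Z' | move=> i [/HP|[]]].
case: asboolP => [bs|nbs].
  have [R1 [Z HZ ->] {R nuR uR}] : exists2 R1, nR nu R1 & ~ forall E x (v : bool),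
      {in E, forall i, [/\ m <= i, R1 i & A i]} ->
      halts_with [set i | i \in F ++ E] (prog e) [:: x] v -> f x <> Some (~~ v).
    apply: contrapT => H; apply: nsat; split=> // R1 HR1; apply: contrapT => nH.
    by apply: H; exists R1.
  move=> /existsNP[E /existsNP[x /existsNP[v /not_implyP[HE /not_implyP[Hh /contrapT fx]]]]].
  have [u Hu] := halts_use Hh.
  (* Beyond the use [u], so that later stem elements cannot disturb the computation. *)
  pose m1 := maxn m (maxn u (\max_(i <- E) i).+1).
  have mm1 : m <= m1 by rewrite leq_maxl.
  have um1 : u <= m1 by rewrite !leq_max leqnn orbT.
  have Em1 : {in E, forall i, i < m1}.
    by move=> i iE; rewrite !leq_max !ltnS (@leq_bigmax_seq _ E xpredT id i iE isT) ?orbT.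
  have [//|sat1 F1 ext1] := grow E m1 Z HZ _ mm1 Em1.
  exists [seq Pt i S | i <- E], (F ++ E), m1, e.+1; split=> //; last exact: ext1.
  split=> // k; rewrite ltnS leq_eqVlt => /orP[/eqP->|ke]; last first.
    exact: settled_extends (ext1 _ (leqnSn e)) (vs k ke).
  exists x => R' _ E' v' HE' Hh'; rewrite fx; congr (Some (~~ _)).
  have Hh2 : halts_with [set i | i \in (F ++ E) ++ E'] (prog e) [:: x] v.
    apply: Hu => i iu /=; rewrite [i \in (F ++ E) ++ E']mem_cat; split=> [->//|/orP[//|iE']].
    by have [] := HE' i iE'; rewrite leqNgt (leq_trans iu um1).
  by have := halts_inj Hh2 Hh'; case: (v) (v') => [] [].
move: nuR uR => [Z HZ ->] uR; have [y] := uR (maxn m e).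
rewrite geq_max => /andP[my ey] [Ay Sy].
have [||| sat1 F1 ext1] := grow [:: y] y.+1 Z HZ.
- by move=> i; rewrite inE => /eqP->.
- by rewrite ltnW.
- by move=> i; rewrite inE => /eqP->.
exists [:: Pt y S], (F ++ [:: y]), y.+1, e; split=> //; last 2 first.
- exact: ext1.
- by split=> //; exists y => //; rewrite mem_cat inE eqxx orbT.
by split=> // k ke; apply: settled_extends (ext1 _ (leqnn e)) (vs k ke).
Qed.

(** Otherwise [progress] could be iterated for ever, giving a chain excluded by [no_chain]. *)
Lemma saturate1 (C : finType) (Q : seq (constr C)) (S : pred C) F m e :
  sat f b Q -> valid (mknode Q S F m e) ->
  exists Q1 F1 m1 e1, let nu1 := mknode (Q1 ++ Q) S F1 m1 e1 in
    [/\ sat f b (Q1 ++ Q), valid nu1, extends nu1 (mknode Q S F m e) & saturated nu1].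
Proof.
move=> satQ vQ; apply: contrapT => nosat.
pose nd (t : seq (constr C) * seq nat * nat * nat) :=
  let: (Q1, F1, m1, e1) := t in mknode (Q1 ++ Q) S F1 m1 e1.
pose ok t := [/\ sat f b (t.1.1.1 ++ Q), valid (nd t) & extends (nd t) (mknode Q S F m e)].
have /choice[nxt Hnxt] : forall t, exists t', ok t -> [/\ ok t', extends (nd t') (nd t) &
    if `[< big_stem (nd t) >] then ne (nd t') = (ne (nd t)).+1
    else ne (nd t') = ne (nd t) /\ big_stem (nd t')].
  move=> t; case: (pselect (ok t)) => [okt|]; last by exists t.
  move: (okt); move: t {okt} => [[[Q1 F1] m1] e1] [/= sat1 val1 ext1].
  have [|Q2 [F2 [m2 [e2 [sat2 val2 ext2 st2]]]]] := progress sat1 val1.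
    by move=> sat'; apply: nosat; exists Q1, F1, m1, e1.
  exists (Q2 ++ Q1, F2, m2, e2) => _; rewrite /ok /nd /= -catA; split=> //.
  by split=> //; apply: extends_trans ext1.
pose t i := iter i nxt ([::], F, m, e).
have okt i : ok (t i).
  by elim: i => [|i /Hnxt[]] //; split=> //; apply: extends_refl.
have stp i := Hnxt _ (okt i).
apply: (@no_chain (fun i => nd (t i))).
- by move=> i; have [] := stp i.
- by move=> i; have [] := okt i.
- by move=> i; have [] := okt i; case: (t i) => [[[Q1 F1] m1] e1] /= s _ _; apply: mknode_ex.
(* A step that leaves [ne] unchanged makes the stem big, so the next step raises it. *)
have inc i : ne (nd (t i)) < ne (nd (t i.+2)).
  have [_ [_ [_ _ _ le2 _]] st2] := stp i.+1; have [_ [_ [_ _ _ le1 _]] st1] := stp i.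
  move: st1; case: asboolP => [_ st1|_ [st1 bs]]; first by rewrite -/(t i.+1) in st1; rewrite -st1.
  by move: st2; rewrite (asboolT bs) => ->; rewrite ltnS.
have gt k : exists i, k < ne (nd (t i)).
  elim: k => [|k [i ki]]; first by exists 2; apply: leq_ltn_trans (inc 0).
  by exists i.+2; apply: leq_ltn_trans (inc i).
move=> k; have [i ki] := gt k; case: (asboolP (big_stem (nd (t i)))) => bs.
  by exists i => //; have [y yF ey] := bs; exists y => //; apply: leq_trans ey; apply: ltnW.
have [_ _] := stp i; rewrite asboolF // => -[E [y yF ey]].
exists i.+1; first by rewrite -[ne _]/(ne (nd (nxt (t i)))) E.
by exists y => //; apply: leq_trans ey; rewrite E ltnW.
Qed.

Lemma mknode_cat (C : finType) (Q2 Q : seq (constr C)) S F m e :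
  extends (mknode (Q2 ++ Q) S F m e) (mknode Q S F m e).
Proof.
exists [::]; rewrite cats0; split=> // R [Z /models_cat[_ HZ] ->].
by exists [set i | S (Z i)]; [exists Z | move=> i [|[]]].
Qed.

Lemma valid_extends0 nu' nu : extends nu' nu -> nF nu' = nF nu -> ne nu' = ne nu ->
  valid nu -> valid nu'.
Proof.
move=> ext EF Ee [vF vs]; have [E [_ mm _ _ _]] := ext; split=> [i|k]; rewrite ?EF ?Ee.
  by move=> /vF[? im]; split=> //; apply: leq_trans mm.
by move=> /vs; apply: settled_extends.
Qed.

Lemma saturated_cat (C : finType) (Q2 Q : seq (constr C)) S F m e :
  saturated (mknode Q S F m e) -> saturated (mknode (Q2 ++ Q) S F m e).
Proof.
move=> sat0 /(good_extends (mknode_cat _ _ _ _ _ _))/sat0[big cons]; split=> // R.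
by move=> [Z /models_cat[_ HZ] ->]; apply: cons; exists Z.
Qed.

(** * Stages: many sides sharing one colouring *)

Record state := State {
  sC : finType;
  sL : sC -> label;
  sQ : seq (constr sC);
  sF : label -> seq nat;
  sm : label -> nat;
  se : label -> nat }.

Definition side s p : node :=
  mknode (sQ s) (fun c => @sL s c == p) (sF s p) (sm s p) (se s p).

Definition healthy s := sat f b (sQ s) /\ forall p, good (side s p) -> valid (side s p).

(** The sides are saturated one at a time. Further constraints preserve the saturation of the other
    sides, and a side that is not good is saturated vacuously. *)
Lemma saturate_sides s (l : seq label) : healthy s ->
  exists Q1 F1 m1 e1, let s1 := State (@sL s) (Q1 ++ sQ s) F1 m1 e1 in
    [/\ healthy s1, forall p, extends (side s1 p) (side s p) &
      {in l, forall p, saturated (side s1 p)}].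
Proof.
move=> hs; elim: l => [|p l [Q1 [F1 [m1 [e1 [hs1 ext1 sat1]]]]]].
  by exists [::], (sF s), (sm s), (se s); split=> // p; apply: extends_refl.
set s1 := State _ _ _ _ _ in hs1 ext1 sat1.
case: (pselect (good (side s1 p))) => gp; last first.
  by exists Q1, F1, m1, e1; split=> // q; rewrite inE => /orP[/eqP->|/sat1].
have [Q2 [F2 [m2 [e2 [satQ2 val2 ext2 sat2]]]]] := saturate1 hs1.1 (hs1.2 p gp).
pose upd T (u : T) g q := if q == p then u else g q : T.
exists (Q2 ++ Q1), (upd _ F2 F1), (upd _ m2 m1), (upd _ e2 e1).
set s2 := State _ _ _ _ _.
have E q : side s2 q = if q == p then mknode (Q2 ++ sQ s1) (fun c => @sL s c == p) F2 m2 e2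
    else mknode (Q2 ++ sQ s1) (fun c => @sL s c == q) (F1 q) (m1 q) (e1 q).
  by rewrite /side /s2 /upd /= -catA; case: eqP => [->|].
have ext12 q : extends (side s2 q) (side s1 q).
  by rewrite E; case: eqP => [->|_] //; apply: mknode_cat.
split=> [|q|q].
- split=> [|q]; first by rewrite /= -catA.
  move=> /(good_extends (ext12 q))/(hs1.2 q); rewrite E; case: eqP => // _.
  exact: (valid_extends0 (mknode_cat _ _ _ _ _ _)).
- exact: extends_trans (ext12 q) (ext1 q).
rewrite E inE; case: eqP => [_ _|_ /sat1] //; exact: saturated_cat.
Qed.

Lemma side_label s p : good (side s p) -> exists c, @sL s c = p.
Proof. by move=> [R [Z _ ->] /(_ 0)[i _ [_ /eqP]]]; exists (Z i). Qed.

Lemma saturate s : healthy s -> exists Q1 F1 m1 e1,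
  let s1 := State (@sL s) (Q1 ++ sQ s) F1 m1 e1 in
  [/\ healthy s1, forall p, extends (side s1 p) (side s p) & forall p, saturated (side s1 p)].
Proof.
move=> /(saturate_sides [seq @sL s c | c <- enum (sC s)])[Q1 [F1 [m1 [e1 [h1 ext1 sat1]]]]].
exists Q1, F1, m1, e1; split=> // p gp; have [c cp] := side_label gp.
by apply: (sat1 p) => //; rewrite -cp; apply/map_f; rewrite mem_enum.
Qed.

(* The share of a block that side [j] must have to be active, and the share
   that is split off from it in a failure step, as [1 / quota j], [1 / loss j]. *)
Definition quota (j : nat) : nat := d * 2 ^ j.+1.
Definition loss (j : nat) : nat := (2 * quota j) * (2 * quota j).

(* The last clause says that each split of side [j] costs it [1 / loss j] of the block. *)
Definition structured t s n0 : Prop := forall Z, models f b Z (sQ s) -> forall n, n0 <= n ->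
  exists h, [/\ size h = t, all (fun al => al.1.1 < t) h,
    forall x, blk b n x -> (@sL s (Z x)).1 = h /\ (@sL s (Z x)).2 <= t &
    forall j, loss j * cnt b n (fun x => @sL s (Z x) == (h, j))
      + count (fun al => al.1.1 == j) h * bsize b n <= loss j * bsize b n].

Definition stage t s : Prop := healthy s /\ exists n0, structured t s n0.

(** Side [t.+1] continues the parent named by [al], any other side continues the one with its
    number. By the first clause the parent was good even when [i] is another side; this is what
    keeps the final path within good sides. *)
Definition follows t s s' : Prop := forall al h i, good (side s' (al :: h, i)) ->
  [/\ good (side s (h, al.1.1)),
    extends (side s' (al :: h, i)) (side s (h, if i == t.+1 then al.1.1 else i)) &
    i = t.+1 -> se s (h, al.1.1) < se s' (al :: h, i)].

Lemma stage_saturate t s : stage t s ->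
  exists s', [/\ stage t s', forall p, extends (side s' p) (side s p) &
    forall p, saturated (side s' p)].
Proof.
move=> [hs [n0 st]]; have [Q1 [F1 [m1 [e1 [h1 ext1 sat1]]]]] := saturate hs.
exists (State (@sL s) (Q1 ++ sQ s) F1 m1 e1); split=> //; split=> //; exists n0 => Z.
by move=> /models_cat[_ /st].
Qed.

Lemma stage0 : exists s, [/\ stage 0 s & forall p, saturated (side s p)].
Proof.
pose s := @State unit (fun=> ([::], 0)) [::] (fun=> [::]) (fun=> 0) (fun=> 0).
have [|s' [st' _ sat']] := @stage_saturate 0 s; last by exists s'.
split.
  by split=> [|p _]; [exists (fun=> tt) | split].
exists 0 => Z _ n _; exists [::]; split=> // j; rewrite mul0n addn0 leq_mul2l.
by rewrite cnt_bsize orbT.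
Qed.

(** * The failure step: splitting a side *)

Section Failure.
Variables (t n0 : nat) (s : state).
Hypothesis s_healthy : healthy s.
Hypothesis s_structured : structured t s n0.
Hypothesis s_saturated : forall p, saturated (side s p).

Notation C := (sC s).
Notation L := (@sL s).

Let gd : pred C := fun c => `[< good (side s (L c)) >].

(** A colouring by [C * bool] encodes a candidate [(X, Y)]; the reservoir tested is the part of [Y]
    in the side of [c]. *)
Definition side_test (c : C) : test (C * bool) :=
  Test (fun z => (L z.1 == L c) && z.2) (sm s (L c)) (sF s (L c)) (prog (se s (L c))).

Definition side_tests : seq (test (C * bool)) := [seq side_test c | c <- enum C & gd c].

Definition candidate_system n1 : seq (constr (C * bool)) :=
  [seq pull fst c | c <- sQ s] ++
  Loc n1 [seq [:: ((fun z : C * bool => (L z.1 == L c) && z.2) : pred (C * bool),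
                   quota (L c).2)] | c <- enum C & gd c] ::
  [seq Consistent T | T <- side_tests].

Lemma side_tests_consistent n1 Z : models f b Z (candidate_system n1) ->
  AllP (fun T => hold f b Z (Consistent T)) side_tests.
Proof. by move=> /models_cat[_ [_ /AllP_map]]. Qed.

(** If [A] met such a side infinitely often, the colouring [Z] itself would witness that the side is
    good; and there are only finitely many colours. *)
Lemma inactive_bound (Z : nat -> C) : models f b Z (sQ s) ->
  exists n1, forall c, ~~ gd c -> forall x, L (Z x) = L c -> A x -> x < b ^ n1.
Proof.
move=> HZ; have /choice[N HN] : forall c, exists N, ~~ gd c ->
    forall x, L (Z x) = L c -> A x -> x < N.
  move=> c; case: (boolP (gd c)) => [_|/asboolPn ngd]; first by exists 0.
  apply: contrapT => /forallNP H; apply: ngd.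
  exists [set i | L (Z i) == L c]; first by exists Z.
  move=> n; have /existsNP[_ /existsNP[x /existsNP[Lx /existsNP[Ax /negP]]]] := H n.
  by rewrite -leqNgt => nx; exists x => //; split=> //; apply/eqP.
exists (\max_c N c) => c /HN H x Lx Ax; apply: ltn_trans (ltn_expl _ b_gt1).
apply: leq_trans (H x Lx Ax) _; exact: leq_bigmax.
Qed.

(** The model is [(Z, A)]. Consistency is saturation, and [heavy_side] finds a side with its share
    of [A], which is active because it meets [A] beyond the bound of [inactive_bound]. *)
Lemma candidate_system_sat : exists n1, [/\ n0 <= n1 & sat f b (candidate_system n1)].
Proof.
have [Z HZ] := s_healthy.1; have [m Hm] := inactive_bound HZ.
pose n1 := maxn (maxn n0 nA) m; exists n1; split; first by rewrite !leq_max leqnn.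
exists (fun x => (Z x, x \in A)); apply/models_cat; split; first exact/models_pull.
split; last first.
  apply/AllP_map/AllP_filter_map => c /asboolP gc x v [E HE Hh].
  have [_] := s_saturated gc.
  apply; [by exists Z | | exact: Hh] => i /HE /= /andP[mi /andP[/eqP Li /set_mem Ai]].
  by split=> //; apply/eqP.
move=> n n1n /=; have n0n : n0 <= n by apply: leq_trans n1n; rewrite !leq_max leqnn.
have nAn : nA <= n by apply: leq_trans n1n; rewrite !leq_max leqnn orbT.
have mn : m <= n by apply: leq_trans n1n; rewrite leq_max leqnn orbT.
have [h [_ _ Hh _]] := s_structured HZ n0n.
have [j jt Hj] := @heavy_side b b_gt1 n d t (fun x => x \in A) (fun x => (L (Z x)).2)
   (fun x bx => (Hh x bx).2) (A_dense nAn).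
have [x bx /andP[/eqP xj /set_mem xA]] : exists2 x, blk b n x & ((L (Z x)).2 == j) && (x \in A).
  apply: (cnt_gt0 (b := b)); have := bsize_gt0 b_gt1 n.
  by move: Hj; case: (cnt _ _ _) => //; rewrite muln0 leqn0 => /eqP->.
have gx : gd (Z x).
  apply: contraT => /Hm /(_ x erefl xA); have [nx _] := andP bx.
  by rewrite ltnNge (leq_trans _ nx) // leq_exp2l.
apply/has_filter_map; exists (Z x) => //=; rewrite andbT xj.
apply: leq_trans Hj _; rewrite leq_mul2l; apply/orP; right; apply: cnt_le => y /Hh[Ly _].
move=> /andP[/eqP yj ->]; rewrite andbT [L (Z y)]surjective_pairing Ly yj.
by rewrite [L (Z x)]surjective_pairing xj (Hh x bx).1.
Qed.

Variables (n1 M K : nat) (Qf : 'I_M -> seq (constr (C * bool))).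
Hypothesis n01 : n0 <= n1.
Hypothesis Qf_sat : forall r, sat f b (Qf r).
Hypothesis Qf_candidate : forall r Z, models f b Z (Qf r) -> models f b Z (candidate_system n1).
Hypothesis Qf_separated : forall r r' : 'I_M, r < r' -> conflicting f b side_tests (Qf r) (Qf r').
Hypothesis K_ge : forall c, 2 * quota (L c).2 <= K.
Hypothesis M_ge : #|C| * K <= M.
Hypothesis M_gt0 : 0 < M.

Notation newC := (split_colour C M).
Notation newL := (@new_label C L M t).
Notation hist := (@new_history C L M).

(** The share [1 / 1] forces the same history on the whole block; the second clause makes the new
    side a definite fraction of it. *)
Definition split_system : seq (constr newC) :=
  flatten [seq [seq pull (fun w : newC => w.1 r) c | c <- Qf r] | r <- enum 'I_M] ++
  [:: Loc n1 [seq [:: ((fun w => (newL w).1 == hist a) : pred newC, 1);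
                      ((fun w => newL w == (hist a, t.+1)) : pred newC, loss (L a.1.1).2)]
                | a <- enum {: C * 'I_M * 'I_M} & gd a.1.1]].

Lemma split_systemP W : models f b W split_system <->
  (forall r, models f b (fun x => (W x).1 r) (Qf r)) /\
  forall n, n1 <= n -> exists2 a, gd a.1.1 &
    (forall x, blk b n x -> (newL (W x)).1 = hist a) /\
    bsize b n <= loss (L a.1.1).2 * cnt b n (fun x => newL (W x) == (hist a, t.+1)).
Proof.
rewrite models_cat /models AllP_flatten AllP_map AllP_mem /=.
have -> : {in enum 'I_M, forall r, AllP (hold f b W) [seq pull (fun w : newC => w.1 r) c | c <- Qf r]}
   <-> forall r, models f b (fun x => (W x).1 r) (Qf r).
  have E r := @models_pull newC _ (fun w : newC => w.1 r) f b W (Qf r).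
  by split=> H r; [apply/E/H; rewrite mem_enum | move=> _; apply/E/H].
split=> -[H1 H2]; split=> //; last first.
  split=> // n /H2[a ga [Ha Hb]]; apply/has_filter_map; exists a => //=; rewrite Hb andbT mul1n.
  by rewrite andbT; apply: cnt_le => x /Ha ->; rewrite eqxx.
move: H2 => [H2 _] n /H2/has_filter_map[a ga /= /and3P[Ha Hb _]]; exists a => //; split=> // x bx.
rewrite mul1n in Ha; exact/eqP/(@cnt_full b n _ x Ha bx).
Qed.

(** Superpose models of all [Qf r] and announce on block [n] the triple found by
    [candidates_overlap]; [trunc_log] recovers the block of [x]. *)
Lemma split_sat : sat f b split_system.
Proof.
have /choice[Z HZ] := Qf_sat.
have [c0 _] : exists c : C, True by exists (Z (Ordinal M_gt0) 0).1.
have d0 : 0 < d.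
  have := leq_trans (bsize_gt0 b_gt1 nA) (A_dense (leqnn nA)).
  by rewrite muln_gt0 => /andP[].
have /choice[al Hal] : forall n, exists a : C * 'I_M * 'I_M, n1 <= n -> gd a.1.1 /\
    bsize b n <= loss (L a.1.1).2 *
      cnt b n (fun x => overlap L [ffun r => Z r x] (L a.1.1) a.1.2 a.2).
  move=> n; case: (leqP n1 n) => n1n; last by exists (c0, Ordinal M_gt0, Ordinal M_gt0).
  have [r|a Ha] := @candidates_overlap C L M b d gd Z n K b_gt1 d0 M_gt0 K_ge M_ge; last by exists a.
  have [_ [Hloc _]] := (models_cat _ _ _ _ _).1 (Qf_candidate (HZ r)).
  by have /has_filter_map[c gc /= /andP[Hc _]] := Hloc n n1n; exists c.
exists (fun x => ([ffun r => Z r x], al (trunc_log b x))); apply/split_systemP.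
split=> [r|n n1n].
  have -> : (fun x => [ffun r => Z r x] r) = Z r by apply: funext => x; rewrite ffunE.
  exact: HZ.
have [ga Ha] := Hal n n1n; exists (al n) => //.
pose Z1 := Z (al n).1.2.
have mZ1 : models f b (fun x => (Z1 x).1) (sQ s).
  by have [/models_pull] := (models_cat _ _ _ _ _).1 (Qf_candidate (HZ (al n).1.2)).
have [h [_ _ Hh _]] := s_structured mZ1 (leq_trans n01 n1n).
(* The overlap is nonempty and its points have the history of the announced colour, so no point of
   the block receives the junk label. *)
have hE : h = (L (al n).1.1).1.
  have [y by_ /and5P[_ /eqP Ly _ _ _]] : exists2 y, blk b n y &
      overlap L [ffun r => Z r y] (L (al n).1.1) (al n).1.2 (al n).2.
    apply: (cnt_gt0 (b := b)); have := bsize_gt0 b_gt1 n.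
    by move: Ha; case: (cnt _ _ _) => //; rewrite muln0 leqn0 => /eqP->.
  by rewrite -Ly ffunE; have [] := Hh y by_.
have lab x : blk b n x -> newL ([ffun r => Z r x], al (trunc_log b x)) =
    (hist (al n), if overlap L [ffun r => Z r x] (L (al n).1.1) (al n).1.2 (al n).2
                  then t.+1 else (L (Z1 x).1).2).
  move=> bx; rewrite (blk_log b_gt1 bx) /new_label /= !ffunE -/Z1.
  by have [-> ->] := Hh x bx; rewrite hE eqxx.
split=> [x /lab-> //|]; apply: leq_trans Ha _; rewrite leq_mul2l; apply/orP; right.
by apply: cnt_le => x /lab-> ->.
Qed.

Definition parent (p : label) : label :=
  if p.1 is al :: h then (h, if p.2 == t.+1 then al.1.1 else p.2) else p.

Definition split_state : state := State newL split_system
  (fun p => sF s (parent p)) (fun p => sm s (parent p))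
  (fun p => (p.2 == t.+1) + se s (parent p)).

Lemma candidate_models W r : models f b W split_system ->
  models f b (fun x => ((W x).1 r).1) (sQ s).
Proof.
by move=> /split_systemP[/(_ r)/Qf_candidate/models_cat[/models_pull]].
Qed.

(** The first candidate [r] of the pair carries the old colouring on: off the overlap it gives the
    unchanged side, on the overlap the side that was split. *)
Lemma split_label_parent w al h i (r : 'I_M) : newL w = (al :: h, i) -> al.1.2 = r ->
  L (w.1 r).1 = parent (al :: h, i).
Proof.
move=> /new_labelP[r1 [r1' [-> hr st ->]]] /= /val_inj <-; rewrite /parent /=.
case: (boolP (overlap _ _ _ _ _)) => [/and5P[_ /eqP-> _ _ _]|_]; first by rewrite eqxx.
by rewrite [LHS]surjective_pairing hr; case: eqP => // E; rewrite E ltnn in st.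
Qed.

(** The split side [j] loses the overlap, at least [1 / loss j] of the block, which pays for its
    count going up by one. Other old sides gain nothing, and sides beyond [t] have count 0. *)
Lemma split_structured : structured t.+1 split_state n1.
Proof.
move=> W mW n n1n; have [_ /(_ n n1n)[a ga [Ha Hb]]] := (split_systemP W).1 mW.
have mX := candidate_models a.1.2 mW; set X := fun x => _ in mX.
have [h [sh ht Hh Hm]] := s_structured mX (leq_trans n01 n1n).
set j := (L a.1.1).2; set g := (L a.1.1).1.
have labP x : blk b n x -> [/\ (L (X x)).1 = g, (L (X x)).2 <= t &
    (newL (W x) = (hist a, t.+1) /\ L (X x) = (g, j)) \/ newL (W x) = (hist a, (L (X x)).2)].
  move=> bx; have E : newL (W x) = ((j, val a.1.2, val a.2) :: g, (newL (W x)).2).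
    by rewrite [LHS]surjective_pairing Ha.
  have [r [r' [[/val_inj Er _] hr st Ei]]] := new_labelP E; subst r.
  split=> //; move: Ei; case: ifP => [/and5P[_ /eqP Lj _ _ _]|_] Ei; [left|right].
    by rewrite E Ei.
  by rewrite [LHS]E Ei.
have bn : blk b n (b ^ n) by rewrite /blk leqnn /= ltn_exp2l.
have hg : h = g by have [<- _] := Hh _ bn; have [] := labP _ bn.
have jt : j <= t.
  have [x bx /eqP Ex] : exists2 x, blk b n x & newL (W x) == (hist a, t.+1).
    apply: (cnt_gt0 (b := b)); have := bsize_gt0 b_gt1 n.
    by move: Hb; case: (cnt _ _ _) => //; rewrite muln0 leqn0 => /eqP->.
  have [_ st [[_ Lx]|]] := labP x bx; first by rewrite Lx in st.
  by rewrite Ex => -[E]; rewrite -E ltnn in st.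
exists (hist a); change (@sL split_state) with newL; split.
- by rewrite /new_history /= -/g -hg sh.
- rewrite /new_history /= -/j -/g -hg ltnS jt; apply: sub_all ht => al; exact: ltnW.
- move=> x bx; split; first exact: Ha.
  by have [_ st [[-> _]|->]] := labP x bx => //=; apply: leqW.
move=> i; have -> : count (fun al => al.1.1 == i) (hist a) = (j == i) + count (fun al => al.1.1 == i) h.
  by rewrite /new_history /= -/j -/g -hg.
rewrite mulnDl.
have := Hm i; case: (leqP i t) => it Hi; last first.
  have -> : count (fun al => al.1.1 == i) h = 0.
    apply/eqP; rewrite -leqn0 leqNgt -has_count; apply/hasPn => al /(allP ht) lt.
    by apply: contraTN lt => /eqP->; rewrite -leqNgt ltnW.
  rewrite (_ : (j == i) = false) ?mul0n ?addn0; last by apply: contraTF it => /eqP<-; rewrite -leqNgt.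
  by rewrite leq_mul2l cnt_bsize orbT.
have it1 : (t.+1 == i) = false by apply: contraTF it => /eqP<-; rewrite ltnn.
have hE (k k' : nat) : ((hist a, k) == (hist a, k')) = (k == k') by rewrite xpair_eqE eqxx.
case: (eqVneq j i) => [ji|nji].
  rewrite mul1n -ji in Hi *; apply: leq_trans Hi; rewrite addnA leq_add2r.
  apply: leq_trans (leq_add (leqnn _) Hb) _; rewrite -/j -mulnDr leq_mul2l; apply/orP; right.
  apply: cnt_split => x bx; have [Lg st [[-> ->]|->]] := labP x bx.
    by rewrite hg !hE eqxx ji it1 eqxx.
  rewrite !hE (_ : (_ == t.+1) = false) ?addn0; last by apply: contraTF st => /eqP->; rewrite ltnn.
  by rewrite [L (X x)]surjective_pairing Lg hg xpair_eqE eqxx.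
rewrite mul0n add0n; apply: leq_trans Hi; rewrite leq_add2r leq_mul2l; apply/orP; right.
apply: cnt_le => x bx; have [Lg st [[-> _]|->]] := labP x bx; first by rewrite hE it1.
by rewrite hE => /eqP<-; rewrite -hg in Lg; rewrite [L (X x)]surjective_pairing Lg.
Qed.

Lemma split_history p : good (side split_state p) -> exists2 a, gd a.1.1 & p.1 = hist a.
Proof.
move=> [R [W mW ->] uR]; have [_ HW] := (split_systemP W).1 mW.
have [x nx [_ /= /eqP Lx]] := uR (b ^ n1).
have x0 : 0 < x by apply: leq_trans nx; rewrite expn_gt0 ltnW.
have bx := log_blk b_gt1 x0.
have n1n : n1 <= trunc_log b x by rewrite -ltnS -(ltn_exp2l _ _ b_gt1); apply: leq_ltn_trans nx _; case/andP: bx.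
by have [a ga [Ha _]] := HW _ n1n; exists a => //; rewrite -Lx Ha.
Qed.

Lemma good_rank p al h i : p = (al :: h, i) -> good (side split_state p) ->
  exists r r' : 'I_M, [/\ al.1.2 = r, al.2 = r' & i = t.+1 -> r != r'].
Proof.
move=> -> [R [W mW ->] /(_ 0)[x _ [_ /= /eqP /new_labelP[r [r' [Ea _ st Ei]]]]]].
exists r, r'; rewrite Ea; split=> // Et; move: Ei; rewrite Et; case: ifP => [/and5P[]//|_ E].
by rewrite -E ltnn in st.
Qed.

Lemma split_extends al h i : good (side split_state (al :: h, i)) ->
  extends (side split_state (al :: h, i)) (side s (parent (al :: h, i))).
Proof.
move=> /(good_rank erefl)[r [r' [Er _ _]]]; exists [::]; rewrite cats0; split=> //.
  by rewrite /= leq_addl.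
move=> R [W mW ->]; exists [set x | L ((W x).1 r).1 == parent (al :: h, i)].
  by exists (fun x => ((W x).1 r).1) => //; apply: candidate_models.
by move=> x [//|[/= /eqP Lx _]]; apply/eqP/split_label_parent.
Qed.

(** Elements of the new side lie in the reservoirs of both candidates. An output at their conflict
    point [x] would be an output for both, but one avoids [v] and the other [~~ v]; so there is
    none. *)
Lemma split_settled al h : good (side split_state (al :: h, t.+1)) ->
  settled (se s (h, al.1.1)) (side split_state (al :: h, t.+1)).
Proof.
move=> g1; have [r [r' [Er Er' /(_ erefl) rr']]] := good_rank erefl g1.
set p := (h, al.1.1); have pE : parent (al :: h, t.+1) = p by rewrite /parent /= eqxx.
have gp : good (side s p) by rewrite -pE; apply: good_extends (split_extends g1) g1.
have [c cp] := side_label gp; have gc : gd c by apply/asboolP; rewrite cp.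
have ovP (W : nat -> newC) x : newL (W x) = (al :: h, t.+1) -> overlap L (W x).1 p r r'.
  move=> /new_labelP[r1 [r1' [Ea _ st Ei]]].
  have -> : r = r1 by apply: val_inj; rewrite /= -Er Ea.
  have -> : r' = r1' by apply: val_inj; rewrite /= -Er' Ea.
  by move: Ei; case: ifP => // _ E; rewrite -E ltnn in st.
have [x [v Hx]] : exists x (v : bool), forall W, models f b W split_system ->
    safe (fun y => (W y).1 r) side_tests x v /\ safe (fun y => (W y).1 r') side_tests x (~~ v).
  (* Conflicts are given for increasing indices; in the other order the two bits are exchanged. *)
  case: (ltngtP r r') => [lt|lt|/val_inj E]; last by rewrite E eqxx in rr'.
    have [x [v [H1 H2]]] := Qf_separated lt; exists x, v => W /split_systemP[HW _].
    by split; [apply: H1 | apply: H2].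
  have [x [v [H1 H2]]] := Qf_separated lt; exists x, (~~ v) => W /split_systemP[HW _].
  by rewrite negbK; split; [apply: H2 | apply: H1].
exists x => R [W mW ->] E v' HE Hh; have [S1 S2] := Hx W mW.
have HE' y : y \in E -> sm s p <= y /\ overlap L (W y).1 p r r'.
  by move=> /HE[my /eqP/ovP]; rewrite /= pE in my.
have Hp : halts_with [set i | i \in sF s p ++ E] (prog (se s p)) [:: x] v'.
  by move: Hh; rewrite /= pE.
have out (q : 'I_M) : (forall y, overlap L (W y).1 p r r' -> (L ((W y).1 q).1 == p) && ((W y).1 q).2) ->
    outputs (side_test c) (fun y => (W y).1 q) x v'.
  move=> ovq; exists E; last by rewrite /= cp.
  by move=> y /HE'[my /ovq oq]; rewrite /= cp my.
have o1 : outputs (side_test c) (fun y => (W y).1 r) x v'.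
  by apply: out => y /and5P[_ -> -> _ _].
have o2 : outputs (side_test c) (fun y => (W y).1 r') x v'.
  by apply: out => y /and5P[_ _ _ -> ->].
move: S1 S2 => /AllP_filter_map/(_ c gc) S1 /AllP_filter_map/(_ c gc) S2.
by case: v {Hx} S1 S2 => S1 S2; case: v' o1 o2 {Hh Hp out} => // o1 o2.
Qed.

Lemma split_valid p : good (side split_state p) -> valid (side split_state p).
Proof.
move=> gp; have [a ga pa] := split_history gp.
case: p gp pa => [h' i] gp /= ph; rewrite {}ph in gp *.
have [al [h Eh]] : exists al h, hist a = al :: h by do 2 eexists; reflexivity.
rewrite {}Eh in gp *.
have ext := split_extends gp; have [vF vs] := s_healthy.2 _ (good_extends ext gp).
split=> [y|k]; first exact: vF.
rewrite /= /parent /=; case: (eqVneq i t.+1) => [it|nit] /=; last first.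
  move=> ke; apply: settled_extends ext _; apply: vs.
  by rewrite /= /parent /= (negbTE nit).
rewrite it in gp ext vs *; rewrite ltnS leq_eqVlt => /orP[/eqP->|ke].
  exact: split_settled.
by apply: settled_extends ext _; apply: vs; rewrite /= /parent /= eqxx.
Qed.

Lemma split_stage : stage t.+1 split_state.
Proof.
split; last by exists n1; exact: split_structured.
by split; [exact: split_sat | exact: split_valid].
Qed.

Lemma split_follows : follows t s split_state.
Proof.
move=> al h i gp; have [a /asboolP ga [Eal Eh]] := split_history gp; split.
- by move: ga; rewrite [L _]surjective_pairing -Eh Eal.
- exact: split_extends.
by move=> -> /=; rewrite eqxx /parent /= eqxx ltnS.
Qed.

End Failure.

Lemma failure t s : stage t s -> (forall p, saturated (side s p)) ->
  exists s', stage t.+1 s' /\ follows t s s'.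
Proof.
move=> [hs [n0 st]] sat_s; have [n1 [n01 satQ]] := candidate_system_sat hs st sat_s.
(* Chosen so that [K] candidates sharing a colour suffice for an overlap; [k < 2 ^ k] then makes
   [2 ^ k] systems enough. *)
pose K := \max_(c : sC s) 2 * quota (@sL s c).2; pose k := #|sC s| * K.
have [Qs [sQs HQs cQs]] := conflicting_systems f_cf b_gt1 no_completion k satQ
  (fun Z => @side_tests_consistent s n1 Z).
pose Qf (r : 'I_(2 ^ k)) := nth [::] Qs r.
have HQf r : sat f b (Qf r) /\ forall Z, models f b Z (Qf r) -> models f b Z (candidate_system s n1).
  by apply: (AllP_nth [::] _ _).1 HQs _ _; rewrite sQs.
exists (split_state t n1 Qf); split.
  apply: (split_stage hs st (K := K)) n01 _ _ _ _ _ _.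
  - by move=> r; have [] := HQf r.
  - by move=> r; have [] := HQf r.
  - by move=> r r' rr'; apply: PairP_nth cQs rr' _; rewrite sQs.
  - by move=> c; apply: (leq_bigmax c).
  - exact/ltnW/ltn_expl.
  - by rewrite expn_gt0.
apply: (@split_follows t s n1).
by move=> r; have [] := HQf r.
Qed.

Lemma next_stage t s : stage t s /\ (forall p, saturated (side s p)) ->
  exists s', [/\ stage t.+1 s', forall p, saturated (side s' p) & follows t s s'].
Proof.
move=> [st sat_s]; have [s1 [st1 fol]] := failure st sat_s.
have [s2 [st2 ext sat2]] := stage_saturate st1.
exists s2; split=> // al h i g2; have [g e l] := fol al h i (good_extends (ext _) g2).
split=> //; first exact: extends_trans (ext _) e.
by move=> /l lt; apply: leq_trans lt _; have [E [_ _ _]] := ext (al :: h, i).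
Qed.

(** * The infinite construction and the path of sides *)

Lemma A_unbounded : unbounded A.
Proof.
move=> n; have := A_dense (leq_maxr n nA); have := bsize_gt0 b_gt1 (maxn n nA).
case E: (cnt _ _ _) => [|k]; first by rewrite muln0 leqn0 => /lt0n_neq0/negbTE->.
have [|x bx /set_mem Ax] := @cnt_gt0 b (maxn n nA) (fun x => x \in A); first by rewrite E.
exists x => //; have [nx _] := andP bx; apply: leq_trans nx.
by apply: leq_trans (leq_maxl _ _) _; apply/ltnW/ltn_expl.
Qed.

Lemma good_side_ex t s : stage t s -> exists p, good (side s p).
Proof.
move=> [[[Z HZ] _] _]; apply: contrapT => /forallNP nogood.
have /choice[N HN] : forall c : sC s, exists N, forall x, A x -> Z x = c -> x < N.
  move=> c; apply: contrapT => /forallNP H; apply: (nogood (sL c)).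
  exists [set i | sL (Z i) == sL c]; first by exists Z.
  move=> n; have /existsNP[x /existsNP[Ax /existsNP[Zx /negP]]] := H n.
  by rewrite -leqNgt => nx; exists x => //; split=> //; rewrite /= Zx.
have [x mx Ax] := A_unbounded (\max_c N c).
have := HN (Z x) x Ax erefl; rewrite ltnNge (leq_trans _ mx) //; exact: leq_bigmax.
Qed.

(** A good side occurs in a late block, where the inequality of [structured] bounds the total loss
    of side [i] by the whole block. *)
Lemma good_history t s h j : stage t s -> good (side s (h, j)) ->
  [/\ size h = t, all (fun al => al.1.1 < t) h &
    forall i, count (fun al => al.1.1 == i) h <= loss i].
Proof.
move=> [_ [n0 st]] [R [Z mZ ->] uR]; have [x nx [_ /= /eqP Lx]] := uR (b ^ n0).
have x0 : 0 < x by apply: leq_trans nx; rewrite expn_gt0 ltnW.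
have bx := log_blk b_gt1 x0.
have n0n : n0 <= trunc_log b x.
  by rewrite -ltnS -(ltn_exp2l _ _ b_gt1); apply: leq_ltn_trans nx _; case/andP: bx.
have [h' [sh ah Hh Hm]] := st Z mZ _ n0n; have [hE _] := Hh x bx.
rewrite Lx /= in hE; rewrite hE; split=> // i; have := leq_trans (leq_addl _ _) (Hm i).
by rewrite leq_pmul2r // bsize_gt0.
Qed.

Lemma count_unbounded (P : pred nat) : unbounded P -> forall k, exists n, k <= count P (iota 0 n).
Proof.
move=> uP; elim=> [|k [n kn]]; first by exists 0.
have [m nm Pm] := uP n; exists m.+1; rewrite -[m.+1]addn1 iotaD count_cat /= Pm addn0 addn1 ltnS.
by apply: leq_trans kn _; rewrite -(subnKC nm) iotaD count_cat leq_addr.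
Qed.

(* Think of [m.+1] as a child of [par m]: the tree is infinite and finitely branching. *)
Lemma infinite_descent (par : nat -> nat) : (forall m, par m <= m) ->
  (forall j, exists B, forall m, par m = j -> m < B) ->
  exists tau, forall k, par (tau k.+1) = (tau k).+1.
Proof.
move=> par_le /choice[B HB].
(* A path from the root 0, in which an entry [m] stands for the node [m.+1]. *)
pose Pc u := forall i, i < size u ->
  par (nth 0 u i) = if i is i'.+1 then (nth 0 u i').+1 else 0.
pose Lb := fix Lb n := if n is n'.+1 then \max_(m < Lb n') B m.+1 else B 0.
have Lb_gt u : Pc u -> forall i, i < size u -> nth 0 u i < Lb i.
  move=> Hu; elim=> [|i IH] ui; first exact/HB/(Hu 0 ui).
  apply: leq_trans (HB _ _ (Hu i.+1 ui)) _.
  exact: (leq_bigmax (Ordinal (IH (ltnW ui)))).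
have chain m : exists u, Pc (rcons u m).
  elim/ltn_ind: m => m IH; case E: (par m) => [|p].
    by exists [::] => -[|i].
  have pm : p < m by rewrite -E.
  have [u Hu] := IH p pm; exists (rcons u p) => i; rewrite size_rcons ltnS leq_eqVlt.
  case/orP=> [/eqP->|lti].
    by rewrite nth_rcons ltnn eqxx size_rcons nth_rcons size_rcons ltnSn nth_rcons ltnn eqxx.
  rewrite nth_rcons lti Hu //; case: i lti => // i lti.
  by rewrite [in RHS]nth_rcons (ltnW lti).
have [u x Hu|n|tau Htau] := @koenig nat Pc (fun n => iota 0 (Lb n)).
- split=> [i ui|]; last first.
    have := Lb_gt _ Hu (size u); rewrite size_rcons nth_rcons ltnn eqxx mem_iota; exact.
  have := Hu i; rewrite size_rcons ltnS (ltnW ui) nth_rcons ui => /(_ isT) ->.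
  by case: i ui => // i ui; rewrite nth_rcons (ltnW ui).
- apply: contrapT => none.
  (* Entry [i] of a path is below [Lb i], so a path ending in this number reaches level [n]. *)
  have [u Hu] := chain (\max_(i < n) Lb i).
  have su : size u < n.
    rewrite ltnNge; apply/negP => nu; apply: none; exists (take n u); first exact: size_takel.
    move=> i; rewrite size_takel // => ltin; have ltiu := leq_trans ltin nu.
    have := Hu i; rewrite size_rcons ltnS (ltnW ltiu) nth_rcons ltiu nth_take // => /(_ isT) ->.
    by case: i ltin ltiu => // i ltin ltiu; rewrite nth_rcons (ltnW ltiu) nth_take // ltnW.
  have := Lb_gt _ Hu (size u); rewrite size_rcons nth_rcons ltnn eqxx ltnSn => /(_ isT).
  by rewrite ltnNge (leq_bigmax (Ordinal su)).
exists tau => k; have := Htau k.+2 k.+1; rewrite size_mkseq ltnSn => /(_ isT).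
by rewrite !nth_mkseq // ltnW.
Qed.

Lemma forcing_contradiction : False.
Proof.
have [s0 [st0 sat0]] := stage0.
have /choice[nxt Hnxt] : forall ts : nat * state, exists s',
    stage ts.1 ts.2 /\ (forall p, saturated (side ts.2 p)) ->
    [/\ stage ts.1.+1 s', forall p, saturated (side s' p) & follows ts.1 ts.2 s'].
  move=> [t s]; case: (pselect (stage t s /\ forall p, saturated (side s p))) => [/next_stage[s' Hs']|no].
    by exists s'.
  by exists s.
pose S := fix S n := if n is m.+1 then nxt (m, S m) else s0.
have HS n : stage n (S n) /\ forall p, saturated (side (S n) p).
  by elim: n => [//|n /(Hnxt (n, S n))[]].
have fol n : follows n (S n) (S n.+1) by have [] := Hnxt (n, S n) (HS n).
(* König's lemma on histories, reversed because they start with the latest split; each stage has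
   finitely many colours. *)
have [u al [j gj]|n|Z HZ] := @koenig _ (fun u => exists j, good (side (S (size u)) (rev u, j)))
    (fun n => [seq head (0, 0, 0) (sL c).1 | c <- enum (sC (S n.+1))]).
- rewrite size_rcons rev_rcons in gj; have [_ e _] := fol _ _ _ _ gj; split.
    by exists (if j == (size u).+1 then al.1.1 else j); apply: good_extends e gj.
  have [c cE] := side_label gj; apply/mapP; exists c; first by rewrite mem_enum.
  by rewrite cE.
- have [[h j] g] := good_side_ex (HS n).1; have [sh _ _] := good_history (HS n).1 g.
  by exists (rev h); [rewrite size_rev | exists j; rewrite size_rev sh revK].
pose h n := rev (mkseq Z n); pose par n := (Z n).1.1.
have hS n : h n.+1 = Z n :: h n by rewrite /h mkseqS rev_rcons.
have gh n : exists j, good (side (S n) (h n, j)) by have := HZ n; rewrite size_mkseq.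
have gpar n : good (side (S n) (h n, par n)).
  by have [j] := gh n.+1; rewrite hS => /fol[].
have par_le n : par n <= n.
  have [j /(good_history (HS n.+1).1)[_ + _]] := gh n.+1.
  by rewrite hS /= ltnS => /andP[].
(* Along [Z] the side [j] is split at most [loss j] times. *)
have par_fin j : exists B, forall m, par m = j -> m < B.
  apply: contrapT => /forallNP inf.
  have [n|n] := @count_unbounded (fun m => par m == j) _ (loss j).+1.
    have /existsNP[m /existsNP[pm /negP]] := inf n; rewrite -leqNgt => nm.
    by exists m => //; apply/eqP.
  rewrite ltnNge; apply/negP; rewrite negbK.
  have [i /(good_history (HS n).1)[_ _ /(_ j)]] := gh n.
  by rewrite /h count_rev /mkseq count_map.
have [tau Htau] := infinite_descent par_le par_fin.
(* Side [m.+1] arises from its parent at stage [m], with one more requirement met, and keeps its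
   number up to stage [n]. *)
have lift m n : m < n -> good (side (S n) (h n, m.+1)) ->
    extends (side (S n) (h n, m.+1)) (side (S m) (h m, par m)) /\
    se (S m) (h m, par m) < se (S n) (h n, m.+1).
  elim: n => // n IH; rewrite ltnS leq_eqVlt hS => /orP[/eqP<-|mn] g.
    by have [_ + /(_ erefl)] := fol _ _ _ _ g; rewrite eqxx.
  have [_ e _] := fol _ _ _ _ g.
  rewrite (_ : (m.+1 == n.+1) = false) in e; last by rewrite eqSS ltn_eqF.
  have [e1 l1] := IH mn (good_extends e g); split; first exact: extends_trans e e1.
  by apply: leq_trans l1 _; have [E [_ _ _]] := e.
(* The side about to be split at stage [tau k]; the split creates side [(tau k).+1], which is the
   one split at stage [tau k.+1]. *)
pose nu k := side (S (tau k)) (h (tau k), par (tau k)).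
have step k : extends (nu k.+1) (nu k) /\ ne (nu k) < ne (nu k.+1).
  rewrite /nu Htau; apply: lift; first by rewrite -Htau.
  by rewrite -Htau.
have ge k : k <= ne (nu k) by elim: k => // k IH; apply: leq_ltn_trans IH (step k).2.
apply: (no_chain (nu := nu)) => [k|k|k|k].
- exact: (step k).1.
- exact: (HS (tau k)).1.1.2 _ (gpar _).
- exact: mknode_ex (HS (tau k)).1.1.1.
exists k.+1; first exact: ge.
have [[y yF ly] _] := (HS (tau k.+1)).2 _ (gpar _).
by exists y => //; apply: leq_trans ly; apply/ltnW/ge.
Qed.

End Forcing.

(** * Lower density *)

Import Order.TTheory GRing.Theory Num.Theory.

Local Open Scope ring_scope.

Lemma lower_density_gt0 (R : realType) (A : set nat) : (0 < lower_density R A)%E ->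
  exists k N, forall n, (N <= n)%N ->
    (n.+1 <= k * #|[pred i : 'I_n.+1 | (i : nat) \in A]|)%N.
Proof.
rewrite /lower_density; set u := fun n : nat => _.
have -> : limn_einf u = ereal_sup (range (einfs u)).
  by rewrite limn_einf_lim; apply/cvg_lim => //; exact: cvg_einfs_sup.
move=> /ereal_sup_gt[_ [N _ <-] infN].
(* The infimum is an extended real; in the infinite case any positive real will do. *)
have [a a0 Ha] : exists2 a : R, 0 < a & (a%:E <= einfs u N)%E.
  case: (einfs u N) infN => [r r0||] //; first by exists r.
  by move=> _; exists 1; rewrite ?leey.
pose k := Num.Def.archi_bound a^-1; exists k, N => n Nn.
have ak : 1 <= k%:R * a.
  by rewrite -ler_pdivrMr // div1r ltW // archi_boundP // invr_ge0 ltW.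
have : (a%:E <= u n)%E by apply: le_trans Ha _; apply: ereal_inf_lbound; exists n.
rewrite lee_fin ler_pdivlMr ?ltr0n // => an.
rewrite -(ler_nat R) natrM; apply: le_trans (ler_wpM2l (ler0n R k) an).
by rewrite mulrA ler_peMl.
Qed.

(** With $b = 2k$ the set has at least $b^{n+1}/k = 2b^n$ elements below $b^{n+1}$. At most $b^n$ of
    them lie below $b^n$, so at least $b^n$ lie in the block. *)
Lemma dense_blocks (A : set nat) k N : (forall n, (N <= n)%N ->
    (n.+1 <= k * #|[pred i : 'I_n.+1 | (i : nat) \in A]|)%N) ->
  exists2 b, (1 < b)%N &
    forall n, (N <= n)%N -> (bsize b n <= b * cnt b n (fun x => x \in A))%N.
Proof.
move=> HA; have k0 : (0 < k)%N by have := HA N (leqnn N); case: (k).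
exists (2 * k)%N; first by lia.
set b := (2 * k)%N => n Nn.
have b1 : (1 < b)%N by rewrite /b; lia.
have bn : (0 < b ^ n.+1)%N by rewrite expn_gt0 ltnW.
have Nb : (N <= (b ^ n.+1).-1)%N.
  by rewrite -ltnS prednK //; apply: leq_ltn_trans Nn (ltnW (ltn_expl _ b1)).
have := HA _ Nb; rewrite prednK //.
have -> : (#|[pred i : 'I_(b ^ n.+1) | (i : nat) \in A]| = \sum_(x < b ^ n.+1) (val x \in A))%N.
  by rewrite -sum1_card big_mkcond; apply: eq_bigr => i _; rewrite inE /=; case: (_ \in A).
have : (\sum_(x < b ^ n.+1) (val x \in A) <= b ^ n + cnt b n (fun x => x \in A))%N.
  have -> : (b ^ n = \sum_(x < b ^ n.+1) (val x < b ^ n))%N.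
    have le_b : (b ^ n <= b ^ n.+1)%N by rewrite leq_exp2l.
    rewrite -[LHS]card_ord -sum1_card (big_ord_widen _ (fun=> 1%N) le_b) big_mkcond.
    by apply: eq_bigr => x _; case: ltnP.
  rewrite /cnt -big_split /=; apply: leq_sum => x _.
  by case: ltnP => _; case: (_ \in A).
have : (bsize b n <= b ^ n.+1)%N.
  rewrite -[X in (_ <= X)%N]card_ord -sum1_card; apply: leq_sum => x _.
  by case: (_ && _).
move: (\sum_(x < _) _)%N => w; rewrite expnS; move: (bsize b n) (cnt _ _ _) (b ^ n)%N => u v p.
rewrite /b => up wp pw; have : (k * w <= k * (p + v))%N by rewrite leq_mul2l wp orbT.
have : (p <= v)%N -> (u <= 2 * k * v)%N.
  by move=> pv; apply: leq_trans up _; rewrite leq_mul2l pv orbT.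
move=> Huv kw; apply: Huv; rewrite -(leq_pmul2l k0); lia.
Qed.

Theorem theorem5p3 (R : realType) (f : nat -> option bool)
    (f_computable : computable f)
    (f_no_completion : ~ exists g : nat -> bool,
        completion f g /\ computable (as_partial g))
    (A : set nat) (A_dense : (0 < lower_density R A)%E) :
  exists B : set nat,
    [/\ B `<=` A, infinite_set B &
        ~ exists g : nat -> bool, completion f g /\ computes B (as_partial g)].
Proof.
have [cf _ f_cf] := f_computable.
have [k [N HA]] := lower_density_gt0 A_dense; have [b b1 Hb] := dense_blocks HA.
apply: contrapT => /forallNP noB.
apply: (forcing_contradiction f_cf f_no_completion b1 Hb) => B BA infB.
by apply: contrapT => nog; apply: (noB B).
Qed.
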